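(* Let $\mathbb G=\mathrm{GL}_n(\mathbb C)$ and let $I,J\in\mathrm{GL}_n(\mathbb C)$ be such that $\theta(g)=I\,g\,I^{-1}$ and $\sigma(g)=J\,{}^tg^{-1}J^{-1}$ define commuting involutions of $\mathbb G$ (the case $I=\mathbf 1_n$, $\theta=\mathrm{id}$, is allowed). Put $\mathbb K=\mathbb G^\theta$, $G=\mathbb G^\sigma$, $K=G^\theta=\mathbb K^\sigma$. Let $\mathbb P\subset\mathbb G$ and $\mathbb Q\subset\mathbb K$ be any $\sigma$-stable parabolic subgroups. Then the following condition (E) is satisfied: (E) $\mathbb P$ and $\mathbb Q$ admit $(-\sigma)$-square roots, and for any $\sigma$-stable parabolic subgroups $\mathbb P_1\subset\mathbb G$ and $\mathbb Q_1\subset\mathbb K$ which are conjugate to $\mathbb P$ and $\mathbb Q$ respectively, the intersection $\mathbb P_1\cap\mathbb Q_1$ also admits $(-\sigma)$-square roots. In particular, with $P=\mathbb P^\sigma=\mathbb P\cap G$, $Q=\mathbb Q^\sigma=\mathbb Q\cap K$, $\mathfrak X=K/Q\times G/P$ and $\mathbb X=\mathbb K/\mathbb Q\times\mathbb G/\mathbb P$, the orbit map $\mathfrak X/K\to\mathbb X/\mathbb K$, $\mathcal O\mapsto\mathbb K\cdot\mathcal O$, induced by the natural embedding $\mathfrak X\hookrightarrow\mathbb X$, $(kQ,gP)\mapsto(k\mathbb Q,g\mathbb P)$, is injective.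
   Context: For a $\sigma$-stable subgroup $\mathbb H$ of $\mathbb G$, put $\mathbb H^{-\sigma}=\{h\in\mathbb H:\sigma(h)=h^{-1}\}$. One says that $\mathbb H$ admits $(-\sigma)$-square roots if for every $h\in\mathbb H^{-\sigma}$ there is $f\in\mathbb H^{-\sigma}$ with $h=f^2$. $K$ (resp. $\mathbb K$) acts diagonally on $\mathfrak X$ (resp. $\mathbb X$), and $\mathfrak X/K$, $\mathbb X/\mathbb K$ denote the sets of orbits. Standing assumptions: $G$, $K$, $\mathbb K$ are connected, and $P\subset G$, $Q\subset K$ are parabolic subgroups. *)

(* Defs.v *)
From HB Require Import structures.
From mathcomp Require Import all_boot all_order all_algebra.
From mathcomp Require Import boolp classical_sets functions reals topology.
From mathcomp Require Import complex mpoly.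

Set Implicit Arguments.
Unset Strict Implicit.
Unset Printing Implicit Defensive.

Import GRing.Theory.
Local Open Scope classical_set_scope.
Local Open Scope ring_scope.

(* Subgroups of GL_n(F) are sets of n x n matrices contained in [GL F n].     *)

Definition mx_eval (F : fieldType) (n : nat) (p : {mpoly F[n * n]})
  (A : 'M[F]_n) : F := p.@[fun k => mxvec A ord0 k].

(* An alias of the matrix space, so that its Zariski topology does not        *)
(* compete with the product topology carried by 'M[F]_n for topological F.    *)
Definition zariski (F : fieldType) (n : nat) : Type := 'M[F]_n.

Section ZariskiTopology.
Variables (F : fieldType) (n : nat).

Definition zariski_open (U : set (zariski F n)) : Prop :=
  exists S : set {mpoly F[n * n]},
    U = [set A | exists2 p, S p & mx_eval p A != 0].

Lemma zariski_openT : zariski_open setT.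
Proof.
exists [set 1]; apply/esym; rewrite -subTset => A _ /=.
by exists 1 => //; rewrite /mx_eval meval1 oner_neq0.
Qed.

Lemma zariski_openI : setI_closed zariski_open.
Proof.
move=> _ _ [S ->] [T ->].
exists [set r | exists2 p, S p & exists2 q, T q & r = p * q].
apply/seteqP; split=> A /=.
  move=> [[p Sp pA] [q Tq qA]]; exists (p * q); first by exists p => //; exists q.
  by rewrite /mx_eval mevalM mulf_neq0.
move=> [_ [p Sp [q Tq ->]]]; rewrite /mx_eval mevalM mulf_eq0 negb_or.
by move=> /andP[pA qA]; split; [exists p | exists q].
Qed.

Lemma zariski_open_bigU (I : Type) (f : I -> set (zariski F n)) :
  (forall i, zariski_open (f i)) -> zariski_open (\bigcup_i f i).
Proof.
move=> fop.
exists [set p | [set A | mx_eval p A != 0] `<=` \bigcup_i f i].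
apply/seteqP; split=> A /=; last by move=> [p sp pA]; apply: sp.
move=> [i _ fiA]; have [S fiE] := fop i.
have [p Sp pA] : exists2 p, S p & mx_eval p A != 0 by move: fiA; rewrite fiE.
by exists p => // B pB; exists i => //; rewrite fiE; exists p.
Qed.

HB.instance Definition _ := Choice.copy (zariski F n) 'M[F]_n.
HB.instance Definition _ := isOpenTopological.Build (zariski F n)
  zariski_openT zariski_openI zariski_open_bigU.

Lemma zariski_openE (U : set (zariski F n)) : open U = zariski_open U.
Proof.
rewrite openE; apply/propext; split=> Uop.
  have -> : U =
      \bigcup_(B : {B : set (zariski F n) | zariski_open B /\ B `<=` U}) sval B.
    apply/seteqP; split=> A; last by move=> [[B BU] _ /(proj2 BU)].
    move=> /Uop UA; have [B [Bop BA sBU]] : nbhs_of_open zariski_open A U := UA.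
    by exists (exist _ B (conj Bop sBU)).
  by apply: zariski_open_bigU => -[B BU]; apply: (proj1 BU).
move=> A UA; have nA : nbhs_of_open zariski_open A U.
  by exists U; split=> // B.
exact: nA.
Qed.

Lemma zariski_closedP (Z : set (zariski F n)) :
  closed Z <-> exists S : set {mpoly F[n * n]},
                 Z = [set A | forall p, S p -> mx_eval p A = 0].
Proof.
rewrite -openC zariski_openE; split=> -[S ZE]; exists S.
  rewrite -[Z]setCK ZE; apply/seteqP; split=> A /= nA.
    by move=> p Sp; apply/eqP; apply: contra_notT nA => pA; exists p.
  by move=> [p /nA ->]; rewrite eqxx.
rewrite ZE; apply/seteqP; split=> A /=; last first.
  by move=> [p Sp pA] /(_ p Sp) pA0; rewrite pA0 eqxx in pA.
move=> nA; apply: contrapT => nex; apply: nA => p Sp.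
by apply/eqP; apply: contra_notT nex => pA; exists p.
Qed.

End ZariskiTopology.

Section LinearAlgebraicGroups.
Variables (F : fieldType) (n : nat).
Implicit Types (G H B P A : set 'M[F]_n) (g h x : 'M[F]_n).

Definition GL : set 'M[F]_n := [set g | g \in unitmx].

Definition mx_subgroup H : Prop :=
  [/\ H `<=` GL, H 1%:M,
      (forall g h, H g -> H h -> H (g *m h)) &
      (forall g, H g -> H (invmx g))].

(* GL_n(F) carries the topology induced from the matrix space: it is a        *)
(* principal open subset of it.                                               *)
Definition closed_subgroup H : Prop :=
  mx_subgroup H /\
  exists2 Z : set (zariski F n), closed Z & H = GL `&` Z.

Definition zconnected H : Prop := connected (H : set (zariski F n)).

Definition derived_subgroup H : set 'M[F]_n :=
  smallest mx_subgroup
    [set invmx g *m invmx h *m g *m h | g in H & h in H].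

Definition solvable_subgroup H : Prop :=
  exists k : nat, iter k derived_subgroup H = [set 1%:M].

Definition closed_connected_solvable H : Prop :=
  [/\ closed_subgroup H, zconnected H & solvable_subgroup H].

Definition borel_subgroup G B : Prop :=
  [/\ closed_connected_solvable B, B `<=` G &
      forall B', closed_connected_solvable B' -> B' `<=` G ->
        B `<=` B' -> B' = B].

Definition parabolic_subgroup G P : Prop :=
  [/\ closed_subgroup P, P `<=` G & exists2 B, borel_subgroup G B & B `<=` P].

Definition conjugate_in G H H1 : Prop :=
  exists2 g, G g & H1 = [set g *m h *m invmx g | h in H].

Definition fixed_points (s : 'M[F]_n -> 'M[F]_n) H : set 'M[F]_n :=
  H `&` [set h | s h = h].

Definition stable_under (s : 'M[F]_n -> 'M[F]_n) H : Prop := s @` H = H.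

Definition minus_points (s : 'M[F]_n -> 'M[F]_n) H : set 'M[F]_n :=
  H `&` [set h | s h = invmx h].

Definition admits_minus_square_roots (s : 'M[F]_n -> 'M[F]_n) H : Prop :=
  forall h, minus_points s H h ->
    exists2 f, minus_points s H f & h = f *m f.

(* Doubled letters (GG, KK, PP, QQ) stand for the blackboard-bold groups.     *)
Definition condition_E (s : 'M[F]_n -> 'M[F]_n)
    (GG KK PP QQ : set 'M[F]_n) : Prop :=
  [/\ admits_minus_square_roots s PP, admits_minus_square_roots s QQ &
      forall PP1 QQ1 : set 'M[F]_n,
        parabolic_subgroup GG PP1 -> stable_under s PP1 ->
        parabolic_subgroup KK QQ1 -> stable_under s QQ1 ->
        conjugate_in GG PP PP1 -> conjugate_in KK QQ QQ1 ->
        admits_minus_square_roots s (PP1 `&` QQ1)].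

Definition translate g A : set 'M[F]_n := [set g *m a | a in A].

Definition coset_space G P : set (set 'M[F]_n) := [set translate g P | g in G].

Definition double_flag K Q G P : set (set 'M[F]_n * set 'M[F]_n) :=
  coset_space K Q `*` coset_space G P.

Definition diag_act k (x : set 'M[F]_n * set 'M[F]_n) :=
  (translate k x.1, translate k x.2).

Definition saturate K (X : set (set 'M[F]_n * set 'M[F]_n)) :
    set (set 'M[F]_n * set 'M[F]_n) :=
  [set diag_act k x | k in K & x in X].

Definition orbit_space K (X : set (set 'M[F]_n * set 'M[F]_n)) :
    set (set (set 'M[F]_n * set 'M[F]_n)) :=
  [set saturate K [set x] | x in X].

Definition mulmx_set A B : set 'M[F]_n := [set a *m b | a in A & b in B].

(* The map (kQ, gP) |-> (k QQ, g PP), written without choosing                *)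
(* representatives: kQ QQ = k QQ as Q is contained in QQ (embed_cosets).      *)
Definition embed (QQ PP : set 'M[F]_n) (x : set 'M[F]_n * set 'M[F]_n) :=
  (mulmx_set x.1 QQ, mulmx_set x.2 PP).

Lemma embed_cosets (QQ PP Q P : set 'M[F]_n) k g :
    mx_subgroup QQ -> mx_subgroup PP -> Q `<=` QQ -> P `<=` PP ->
    Q 1%:M -> P 1%:M ->
  embed QQ PP (translate k Q, translate g P) = (translate k QQ, translate g PP).
Proof.
have aux H A h : mx_subgroup H -> A `<=` H -> A 1%:M ->
    mulmx_set (translate h A) H = translate h H.
  move=> [_ _ HM _] sAH A1; apply/seteqP; split=> x /=.
    move=> [_ [a Aa <-] [b Hb <-]]; exists (a *m b); last by rewrite mulmxA.
    by apply: HM => //; apply: sAH.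
  move=> [b Hb <-]; exists h; last by exists b.
  by exists 1%:M => //; rewrite mulmx1.
by move=> hQ hP sQ sP Q1 P1; rewrite /embed /= !aux.
Qed.

Definition orbit_map (KK QQ PP : set 'M[F]_n)
    (O : set (set 'M[F]_n * set 'M[F]_n)) :=
  saturate KK (embed QQ PP @` O).

End LinearAlgebraicGroups.

Arguments GL F n : clear implicits.

Definition theta_inv (F : fieldType) (n : nat) (I g : 'M[F]_n) : 'M[F]_n :=
  I *m g *m invmx I.

Definition sigma_inv (F : fieldType) (n : nat) (J g : 'M[F]_n) : 'M[F]_n :=
  J *m (invmx g)^T *m invmx J.

(* Main.v *)
Require Import Defs.
From HB Require Import structures.
From mathcomp Require Import all_boot all_order all_algebra.
From mathcomp Require Import boolp classical_sets functions reals topology.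
From mathcomp Require Import complex mpoly.
From mathcomp Require Import fingroup perm ring.

(** Why the theorem holds.  A parabolic subgroup of GL_n, or of the centraliser
    KK of I, is the group of invertible elements of a subalgebra of the matrix
    algebra: a block triangular algebra in a suitable basis
    ([parabolic_units]).  The same is then true of an intersection of such
    subgroups.  In the group of units of a subalgebra S, square roots are found
    as follows ([units_minus_square_roots]).  The condition sigma h = h^-1 says
    that h is fixed by the anti-involution A |-> J A^T J^-1.  An invertible
    complex matrix h has a square root f that is a polynomial in h, because X is
    a square modulo any polynomial that does not vanish at 0
    ([sqrt_modulo_split]).  As a polynomial in h, f lies in S and is fixed by
    the anti-involution, that is, sigma f = f^-1.  This gives condition (E).

    The orbit map is injective by a standard argument ([fixed_mover]).  If m in
    KK carries the cosets (k QQ, g PP) to (k' QQ, g' PP), where k, k', g, g' are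
    fixed by sigma, then a = m^-1 sigma(m) stabilises (k QQ, g PP) and
    sigma a = a^-1.  A square root f of a in the stabiliser with
    sigma f = f^-1 makes m f fixed by sigma, and m f moves the same cosets.

    What takes work is the description of parabolic subgroups, starting from
    the definition of a Borel subgroup as a maximal closed connected solvable
    subgroup.  The Lie--Kolchin theorem puts a Borel subgroup B of KK in upper
    triangular form in a basis of eigenvectors of I ([adapted_basis]).  It is
    proved here from one rigidity property of Zariski connected groups
    ([zconnected_eigenvalue]) and the connectedness of derived subgroups
    ([derived_connected]).  The group of all invertible upper triangular
    matrices in KK is itself closed, connected and solvable, so by maximality
    it equals B.  Last, a group P that contains it is determined by the root
    subgroups 1 + t E_ij that P contains: their positions form a preorder, and
    by the Bruhat decomposition P consists of the invertible elements of the
    incidence algebra of that preorder ([overgroupE]). *)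

Set Implicit Arguments.
Unset Strict Implicit.
Unset Printing Implicit Defensive.

Import GRing.Theory.
Local Open Scope classical_set_scope.
Local Open Scope ring_scope.

(** * Polynomial and regular functions on matrices *)

Section RegularFunctions.
Variables (F : fieldType) (n : nat).
Implicit Types (f g : 'M[F]_n -> F) (A : 'M[F]_n).

Definition polyfun f := exists q : {mpoly F[n * n]}, forall A, f A = mx_eval q A.

Lemma polyfun_cst c : polyfun (fun=> c).
Proof. by exists c%:MP => A; rewrite /mx_eval mevalC. Qed.

Lemma polyfun_entry i j : polyfun (fun A => A i j).
Proof.
exists ('X_(mxvec_index i j)) => A.
by rewrite /mx_eval mevalXU mxvecE.
Qed.

Lemma polyfunD f g : polyfun f -> polyfun g -> polyfun (fun A => f A + g A).
Proof.
by move=> [p fp] [q gq]; exists (p + q) => A; rewrite fp gq /mx_eval mevalD.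
Qed.

Lemma polyfunM f g : polyfun f -> polyfun g -> polyfun (fun A => f A * g A).
Proof.
by move=> [p fp] [q gq]; exists (p * q) => A; rewrite fp gq /mx_eval mevalM.
Qed.

Lemma polyfun_sum (I : Type) (s : seq I) (P : pred I) (f : I -> 'M[F]_n -> F) :
  (forall i, polyfun (f i)) -> polyfun (fun A => \sum_(i <- s | P i) f i A).
Proof.
move=> fp; elim: s => [|i s IH].
  by have [q qE] := polyfun_cst 0; exists q => A; rewrite big_nil -qE.
have [Pi|nPi] := boolP (P i).
  have [q qE] := polyfunD (fp i) IH.
  by exists q => A; rewrite big_cons Pi -qE.
by have [q qE] := IH; exists q => A; rewrite big_cons (negPf nPi) -qE.
Qed.

Lemma polyfun_prod (I : Type) (s : seq I) (P : pred I) (f : I -> 'M[F]_n -> F) :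
  (forall i, polyfun (f i)) -> polyfun (fun A => \prod_(i <- s | P i) f i A).
Proof.
move=> fp; elim: s => [|i s IH].
  by have [q qE] := polyfun_cst 1; exists q => A; rewrite big_nil -qE.
have [Pi|nPi] := boolP (P i).
  have [q qE] := polyfunM (fp i) IH.
  by exists q => A; rewrite big_cons Pi -qE.
by have [q qE] := IH; exists q => A; rewrite big_cons (negPf nPi) -qE.
Qed.

Lemma polyfun_det m (M : 'M[F]_n -> 'M[F]_m) :
  (forall i j, polyfun (fun A => M A i j)) -> polyfun (fun A => \det (M A)).
Proof.
move=> Mp; apply: polyfun_sum => s; apply: polyfunM; first exact: polyfun_cst.
by apply: polyfun_prod.
Qed.

(** The coordinate ring of the principal open subset det <> 0 of the matrix
    space: quotients of polynomials by powers of the determinant. *)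
Definition regular f := exists N, exists2 q, polyfun q &
  forall A, A \in unitmx -> f A * \det A ^+ N = q A.

Lemma polyfun_regular f : polyfun f -> regular f.
Proof. by exists 0; exists f => // A _; rewrite mulr1. Qed.

Lemma polyfun_detX N : polyfun (fun A => \det A ^+ N).
Proof.
have dp : polyfun (fun A => \det A) by apply: polyfun_det; exact: polyfun_entry.
elim: N => [|N IH]; first exact: polyfun_cst.
by have [q qE] := polyfunM dp IH; exists q => A; rewrite exprS qE.
Qed.

Lemma regularD f g : regular f -> regular g -> regular (fun A => f A + g A).
Proof.
move=> [N [p pp fE]] [M [q qp gE]]; exists (N + M)%N.
exists (fun A => p A * \det A ^+ M + q A * \det A ^+ N).
  by apply: polyfunD; apply: polyfunM => //; exact: polyfun_detX.
move=> A uA; rewrite -fE // -gE // mulrDl exprD; congr (_ + _).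
  by rewrite mulrA.
by rewrite -mulrA [_ ^+ N * _]mulrC.
Qed.

Lemma regularM f g : regular f -> regular g -> regular (fun A => f A * g A).
Proof.
move=> [N [p pp fE]] [M [q qp gE]]; exists (N + M)%N.
exists (fun A => p A * q A); first exact: polyfunM.
by move=> A uA; rewrite -fE // -gE // exprD mulrACA.
Qed.

Lemma regular_cst c : regular (fun=> c).
Proof. exact/polyfun_regular/polyfun_cst. Qed.

Lemma regular_sum (I : Type) (s : seq I) (f : I -> 'M[F]_n -> F) :
  (forall i, regular (f i)) -> regular (fun A => \sum_(i <- s) f i A).
Proof.
move=> fr; elim: s => [|i s IH].
  have [N [q qp qE]] := regular_cst 0; exists N; exists q => // A uA.
  by rewrite big_nil -qE.
have [N [q qp qE]] := regularD (fr i) IH.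
by exists N; exists q => // A uA; rewrite big_cons -qE.
Qed.

Lemma regular_prod (I : Type) (s : seq I) (f : I -> 'M[F]_n -> F) :
  (forall i, regular (f i)) -> regular (fun A => \prod_(i <- s) f i A).
Proof.
move=> fr; elim: s => [|i s IH].
  have [N [q qp qE]] := regular_cst 1; exists N; exists q => // A uA.
  by rewrite big_nil -qE.
have [N [q qp qE]] := regularM (fr i) IH.
by exists N; exists q => // A uA; rewrite big_cons -qE.
Qed.

Lemma regularX f k : regular f -> regular (fun A => f A ^+ k).
Proof.
move=> fr; elim: k => [|k IH]; first exact: regular_cst.
have [N [q qp qE]] := regularM fr IH.
by exists N; exists q => // A uA; rewrite exprS -qE.
Qed.

End RegularFunctions.

Section RegularMaps.
Variables (F : fieldType) (n : nat).

Definition regular_mx m p (M : 'M[F]_n -> 'M[F]_(m, p)) :=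
  forall i j, regular (fun A => M A i j).

Lemma regular_mx_cst m p (C : 'M[F]_(m, p)) : regular_mx (fun=> C).
Proof. by move=> i j; exact: regular_cst. Qed.

Lemma regular_mx_id : regular_mx (fun A => A).
Proof. by move=> i j; exact/polyfun_regular/polyfun_entry. Qed.

Lemma regular_mxD m p (M N : 'M[F]_n -> 'M[F]_(m, p)) :
  regular_mx M -> regular_mx N -> regular_mx (fun A => M A + N A).
Proof.
move=> Mr Nr i j; have [k [q qp qE]] := regularD (Mr i j) (Nr i j).
by exists k; exists q => // A uA; rewrite mxE -qE.
Qed.

Lemma regular_mxM m p r (M : 'M[F]_n -> 'M[F]_(m, p)) (N : 'M[F]_n -> 'M[F]_(p, r)) :
  regular_mx M -> regular_mx N -> regular_mx (fun A => M A *m N A).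
Proof.
move=> Mr Nr i j.
have [k [q qp qE]] : regular (fun A => \sum_k M A i k * N A k j).
  by apply: regular_sum => k; apply: regularM.
by exists k; exists q => // A uA; rewrite mxE -qE.
Qed.

(** By Cramer's rule the inverse is the adjugate over the determinant. *)
Lemma regular_mxV : regular_mx (fun A => invmx A).
Proof.
move=> i j; exists 1%N; exists (fun A => (\adj A) i j); last first.
  move=> A uA; rewrite /invmx uA mxE expr1 mulrAC mulVf ?mul1r //.
  by move: uA; rewrite unitmxE unitfE.
have [q qE] : polyfun (fun A : 'M[F]_n => cofactor A j i).
  rewrite /cofactor; apply: polyfunM; first exact: polyfun_cst.
  apply: polyfun_det => k l; have [q qE] := polyfun_entry F (lift j k) (lift i l).
  by exists q => A; rewrite !mxE -qE.
by exists q => A; rewrite mxE qE.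
Qed.

Lemma regular_eval_comp m (M : 'M[F]_n -> 'M[F]_m) (p : {mpoly F[m * m]}) :
  regular_mx M -> regular (fun A => mx_eval p (M A)).
Proof.
move=> Mr.
have [k [q qp qE]] : regular (fun A =>
    \sum_(u <- msupp p) p@_u * \prod_i (mxvec (M A)) ord0 i ^+ u i).
  apply: regular_sum => u; apply: regularM; first exact: regular_cst.
  apply: regular_prod => i; apply: regularX.
  have [a b] := mxvec_indexP i; have [k [q qp qE]] := Mr a b.
  by exists k; exists q => // A uA; rewrite mxvecE -qE.
by exists k; exists q => // A uA; rewrite /mx_eval mevalE -qE.
Qed.

(** On invertible matrices a regular function vanishes exactly where its
    numerator does, so its zeros are cut out by a polynomial. *)
Lemma regular_zeros (I : Type) (P : I -> Prop) (f : I -> 'M[F]_n -> F) :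
  (forall i, regular (f i)) ->
  exists2 Z : set (zariski F n), closed Z &
    forall A, A \in unitmx -> (Z A <-> forall i, P i -> f i A = 0).
Proof.
move=> fr.
pose S : set {mpoly F[n * n]} := [set q | exists2 i, P i &
  exists N, forall A, A \in unitmx -> f i A * \det A ^+ N = mx_eval q A].
exists [set A | forall p, S p -> mx_eval p A = 0].
  by apply/zariski_closedP; exists S.
move=> A uA; split=> /=.
  move=> ZA i Pi; have [N [q [p qp] qE]] := fr i.
  have /eqP : f i A * \det A ^+ N = 0.
    rewrite qE // qp; apply: ZA; exists i => //; exists N => B uB.
    by rewrite qE // qp.
  rewrite mulf_eq0 => /orP[/eqP//|]; rewrite expf_eq0 => /andP[_].
  by move: uA; rewrite unitmxE unitfE => /negPf ->.
by move=> fA p [i Pi [N NE]]; rewrite -NE // fA // mul0r.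
Qed.

End RegularMaps.

(** * Zariski connectedness *)

Section Connectedness.
Variable F : fieldType.

Lemma zconnected_image n m (M : 'M[F]_n -> 'M[F]_m) (H : set 'M[F]_n) :
  H `<=` GL F n -> regular_mx M -> zconnected H -> zconnected (M @` H).
Proof.
move=> sH Mr Hc.
have pre (D : set (zariski F m)) : closed D ->
    exists2 D' : set (zariski F n), closed D' & forall A, H A -> (D' A <-> D (M A)).
  move=> /zariski_closedP[S ->].
  have [Z Zc ZE] := @regular_zeros F n {mpoly F[m * m]} S _
    (fun p => regular_eval_comp p Mr).
  by exists Z => // A /sH/ZE.
move=> B [b0 Bb0] [C Co BC] [D Dc BD].
have [D' D'c D'E] := pre D Dc.
have [C' C'c C'E] : exists2 C' : set (zariski F n), closed C' &
    forall A, H A -> (C' A <-> (~` C) (M A)).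
  by apply: pre; rewrite closedC.
have HB : H `&` D' = H.
  apply: Hc.
  - move: Bb0; rewrite BD => -[[h Hh <-] Dh]; exists h; split=> //.
    exact/D'E.
  - exists (~` C'); first by rewrite openC.
    apply/seteqP; split=> h [Hh hD]; split=> //=.
      have Bh : B (M h) by rewrite BD; split; [exists h | exact/D'E].
      by move=> /C'E -/(_ Hh); move: Bh; rewrite BC => -[_ Ch].
    apply/D'E => //; suff : B (M h) by rewrite BD => -[].
    rewrite BC; split; first by exists h.
    by apply: contrapT => nC; apply: hD; apply/C'E.
  - by exists D'.
rewrite BD; apply/seteqP; split=> [x []//|_ [h Hh <-]]; split; first by exists h.
by apply/D'E => //; move: Hh; rewrite -{1}HB => -[].
Qed.

(** A function on a connected set with finitely many values and relatively
    closed fibres is constant: each fibre is also the complement of a finite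
    union of closed sets. *)
Lemma zconnected_finite_valued n (H : set 'M[F]_n) (s : seq F)
    (E : 'M[F]_n -> F -> Prop) :
  zconnected H ->
  (forall h, H h -> exists2 a, a \in s & E h a) ->
  (forall h a b, H h -> E h a -> E h b -> a = b) ->
  (forall a, exists2 Z : set (zariski F n), closed Z &
     forall h, H h -> (Z h <-> E h a)) ->
  forall h0 h a, H h0 -> H h -> E h0 a -> E h a.
Proof.
move=> Hc Es Eu Ecl h0 h a Hh0 Hh Eh0.
have [Z Zc ZE] := Ecl a.
have [Y Yc YE] : exists2 Y : set (zariski F n), closed Y &
    forall h, H h -> (Y h <-> exists2 b, b \in s & b != a /\ E h b).
  elim: s {Es} => [|b s [Y Yc YE]].
    by exists set0; [exact: closed0 | move=> g _; split=> [[]|[]]].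
  have [->|ba] := eqVneq b a.
    exists Y => // g Hg; rewrite YE //; split=> -[c cs cE]; exists c => //.
      by rewrite inE cs orbT.
    by move: cs; rewrite inE => /orP[/eqP cb|//]; case: cE; rewrite cb eqxx.
  have [X Xc XE] := Ecl b.
  exists (X `|` Y); first exact: closedU.
  move=> g Hg; split=> [[/XE|/YE]|[c]].
  - by move=> /(_ Hg) Eb; exists b => //; rewrite inE eqxx.
  - by move=> /(_ Hg)[c cs cE]; exists c => //; rewrite inE cs orbT.
  - rewrite inE => /orP[/eqP->|cs] cE; first by left; apply/XE => //; case: cE.
    by right; apply/YE => //; exists c.
have HZ : H `&` Z = H.
  apply: Hc; first by exists h0; split=> //; apply/ZE.
    exists (~` Y); first by rewrite openC.
    apply/seteqP; split=> g [Hg gP]; split=> //.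
      move=> /YE -/(_ Hg)[b _ [ba Eb]]; case/eqP: ba.
      by apply: (Eu g) => //; apply/ZE.
    have [b bs Eb] := Es g Hg; have [ba|ba] := eqVneq b a.
      by apply/ZE => //; rewrite -ba.
    by case: gP; apply/YE => //; exists b.
  by exists Z.
by apply/ZE => //; move: Hh; rewrite -{1}HZ => -[].
Qed.

(** The key rigidity fact behind the Lie--Kolchin theorem.  The eigenvalue of
    M on v *m h ranges over the finitely many eigenvalues of M, hence does not
    move along a connected set. *)
Lemma zconnected_eigenvalue n (H : set 'M[F]_n) (M : 'M[F]_n) (v : 'rV[F]_n) a :
  H `<=` GL F n -> H 1%:M -> zconnected H -> v != 0 ->
  (forall h, H h -> exists b, v *m h *m M = b *: (v *m h)) ->
  v *m M = a *: v -> forall h, H h -> v *m h *m M = a *: (v *m h).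
Proof.
move=> sH H1 Hc v0 vH vM h Hh.
have vh0 g : H g -> v *m g != 0.
  move=> /sH ug; apply: contraNneq v0 => vg.
  by rewrite -[v](mulmxK ug) vg mul0mx.
have [s sP] : exists s : seq F, forall b, eigenvalue M b -> b \in s.
  have cp0 : char_poly M != 0 by rewrite monic_neq0 ?char_poly_monic.
  have rts (p : {poly F}) : p != 0 -> exists s : seq F, forall b, root p b -> b \in s.
    move: {2}(size p) (leqnn (size p)) => k; elim: k p => [|k IH] p.
      by rewrite leqn0 size_poly_eq0 => ->.
    move=> sp p0; have [[b rb]|nr] := pselect (exists b, root p b); last first.
      by exists [::] => b rb; case: nr; exists b.
    have /factor_theorem[q qE] := rb.
    have q0 : q != 0 by apply: contraNneq p0 => q0; rewrite qE q0 mul0r.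
    have [|s sP] := IH q _ q0.
      by move: sp; rewrite qE size_mul ?polyXsubC_eq0 // size_XsubC addnC.
    exists (b :: s) => c; rewrite qE rootM root_XsubC inE => /orP[/sP->|->//].
    by rewrite orbT.
  by have [s sP] := rts _ cp0; exists s => b; rewrite eigenvalue_root_char => /sP.
have /= := @zconnected_finite_valued n H s
  (fun h b => v *m h *m M = b *: (v *m h)) Hc _ _ _ 1%:M h a H1 Hh.
apply.
- move=> g Hg; have [b bE] := vH g Hg; exists b => //; apply: sP.
  by apply/eigenvalueP; exists (v *m g) => //; exact: vh0.
- move=> g b c Hg /[dup] -> _ /eqP; rewrite -subr_eq0 -scalerBl scaler_eq0.
  by rewrite (negPf (vh0 _ Hg)) orbF subr_eq0 => /eqP.
- move=> b.
  have [|Z Zc ZE] := @regular_zeros F n 'I_n setT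
    (fun i A => (v *m A *m M + (- b)%:M *m (v *m A)) 0 i).
    move=> i; apply: regular_mxD; repeat apply: regular_mxM;
      by [exact: regular_mx_id | exact: regular_mx_cst].
  exists Z => // g Hg; rewrite ZE; last exact: sH.
  split=> [gE|gE i _].
    apply/eqP; rewrite -subr_eq0; apply/eqP/rowP => i.
    by rewrite [RHS]mxE; have := gE i Logic.I; rewrite mul_scalar_mx scaleNr.
  by rewrite gE mul_scalar_mx scaleNr subrr mxE.
- by rewrite mulmx1.
Qed.

End Connectedness.

Section UnitsOfAffineSpaces.
Variable F : numFieldType.

Lemma poly_nonroot (p : {poly F}) : p != 0 -> exists x, p.[x] != 0.
Proof.
move=> p0; apply: contrapT => nx.
suff: (size [seq k%:R : F | k <- iota 0 (size p)] < size p)%N.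
  by rewrite size_map size_iota ltnn.
apply: max_poly_roots => //.
  apply/allP => _ /mapP[k _ ->]; apply: contrapT => /negP pk.
  by apply: nx; exists k%:R.
rewrite map_inj_uniq ?iota_uniq // => a b /eqP.
by rewrite Num.Theory.eqr_nat => /eqP.
Qed.

Lemma mx_eval_line n (q : {mpoly F[n * n]}) (A B : 'M[F]_n) :
  exists r : {poly F}, forall s, mx_eval q (A + s *: B) = r.[s].
Proof.
exists (\sum_(u <- msupp q) (q@_u)%:P *
  \prod_i ((mxvec A ord0 i)%:P + 'X * (mxvec B ord0 i)%:P) ^+ u i) => s.
rewrite /mx_eval mevalE horner_sum; apply: eq_bigr => u _.
rewrite hornerM hornerC horner_prod; congr (_ * _); apply: eq_bigr => i _.
by rewrite horner_exp !hornerE linearD linearZ !mxE.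
Qed.

(** The invertible points of a line through the identity form a line with
    finitely many points removed, which is irreducible; lines through a common
    point make up the whole set. *)
Lemma zconnected_units n (S : set 'M[F]_n) : S 1%:M ->
  (forall A s, S A -> S (1%:M + s *: (A - 1%:M))) -> zconnected (GL F n `&` S).
Proof.
move=> S1 Sl.
pose L (A : 'M[F]_n) : set (zariski F n) :=
  GL F n `&` [set 1%:M + s *: (A - 1%:M) | s in setT].
have LA A : connected (L A).
  move=> B [b0 Bb0] [C Co BC] [D Dc BD].
  rewrite BC; apply/seteqP; split=> [x []//|x Lx]; split=> //; apply: contrapT => nCx.
  move: Co; rewrite zariski_openE => -[SC CE].
  move/zariski_closedP: Dc => [SD DE].
  have [p Sp py] : exists2 p, SC p & mx_eval p b0 != 0.
    by move: Bb0; rewrite BC CE => -[].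
  have [q Sq qx] : exists2 q, SD q & mx_eval q x != 0.
    apply: contrapT => nq; apply: nCx.
    suff : B x by rewrite BC => -[].
    rewrite BD; split=> //; rewrite DE => q Sq; apply: contrapT => /eqP qx.
    by apply: nq; exists q.
  have [d dE] := @polyfun_detX F n 1%N.
  have [rp rpE] := mx_eval_line p 1%:M (A - 1%:M).
  have [rq rqE] := mx_eval_line q 1%:M (A - 1%:M).
  have [rd rdE] := mx_eval_line d 1%:M (A - 1%:M).
  have rp0 : rp != 0.
    apply: contraNneq py => rp0; move: Bb0; rewrite BC => -[[_ [s _ <-]] _].
    by rewrite rpE rp0 horner0.
  have rq0 : rq != 0.
    apply: contraNneq qx => rq0; move: Lx => -[_ [s _ <-]].
    by rewrite rqE rq0 horner0.
  have rd0 : rd != 0.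
    apply/eqP => rd0; move: Lx => -[ux [s _ sE]]; move: ux.
    by rewrite /GL /= unitmxE unitfE -sE -[\det _]expr1 dE rdE rd0 horner0 eqxx.
  have [s] := poly_nonroot (mulf_neq0 (mulf_neq0 rp0 rq0) rd0).
  rewrite !hornerM -rpE -rqE -rdE -dE expr1 !mulf_eq0 !negb_or.
  move=> /andP[/andP[ps qs] ds].
  have Bs : B (1%:M + s *: (A - 1%:M)).
    rewrite BC; split; last by rewrite CE; exists p.
    by split; [rewrite /GL /= unitmxE unitfE | exists s].
  by move: Bs; rewrite BD DE => -[_ /(_ q Sq)] /eqP; rewrite (negPf qs).
have -> : GL F n `&` S = \bigcup_(A in GL F n `&` S) L A.
  apply/seteqP; split=> [A SA|A [B [_ SB] [uA [s _ sE]]]].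
    by exists A => //; split; [case: SA | exists 1; rewrite // scale1r addrC subrK].
  by split=> //; rewrite -sE; exact: Sl.
apply: bigcup_connected => [|A _]; last exact: LA.
exists (1%:M : 'M[F]_n) => A _; split; first exact: unitmx1.
by exists 0; rewrite // scale0r addr0.
Qed.

End UnitsOfAffineSpaces.

(** * Derived subgroups *)

Section Derived.
Variable F : fieldType.

Section FixedSize.
Variable n : nat.
Implicit Types (H K : set 'M[F]_n) (g h x : 'M[F]_n).

Definition mx_comm g h := invmx g *m invmx h *m g *m h.

Lemma invmxM g h : g \in unitmx -> h \in unitmx ->
  invmx (g *m h) = invmx h *m invmx g.
Proof.
move=> ug uh; have ugh : g *m h \in unitmx by rewrite unitmx_mul ug.
apply: (can_inj (mulKmx ugh)); rewrite mulmxV // -mulmxA (mulmxA h) mulmxV //.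
by rewrite mul1mx mulmxV.
Qed.

Lemma derived_comm H g h : H g -> H h -> derived_subgroup H (mx_comm g h).
Proof. by move=> Hg Hh K [_]; apply; exists g => //; exists h. Qed.

Lemma derived_sub H K : mx_subgroup K ->
  (forall g h, H g -> H h -> K (mx_comm g h)) -> derived_subgroup H `<=` K.
Proof. by move=> gK HK; apply: smallest_sub => // _ [g Hg [h Hh <-]]; exact: HK. Qed.

Lemma mx_comm_subgroup H g h : mx_subgroup H -> H g -> H h -> H (mx_comm g h).
Proof.
move=> [_ _ HM HV] Hg Hh.
exact: (HM _ _ (HM _ _ (HM _ _ (HV _ Hg) (HV _ Hh)) Hg) Hh).
Qed.

Lemma derived_subW H : mx_subgroup H -> derived_subgroup H `<=` H.
Proof. by move=> gH; apply: derived_sub => // g h; exact: mx_comm_subgroup. Qed.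

Lemma derived_group H : mx_subgroup H -> mx_subgroup (derived_subgroup H).
Proof.
move=> gH; have [sH H1 HM HV] := gH; split.
- by move=> x /(derived_subW gH)/sH.
- by move=> K [[]].
- move=> g h Dg Dh K KP; case: (KP) => -[_ _ KM _] _.
  by apply: KM; [exact: Dg | exact: Dh].
- by move=> g Dg K KP; case: (KP) => -[_ _ _ KV] _; apply: KV; exact: Dg.
Qed.

Lemma derived_mono H K : H `<=` K -> derived_subgroup H `<=` derived_subgroup K.
Proof.
move=> HK x Dx L [gL KL]; apply: Dx; split=> // _ [g /HK Kg [h /HK Kh <-]].
by apply: KL; exists g => //; exists h.
Qed.

Lemma derived_iter_group H k :
  mx_subgroup H -> mx_subgroup (iter k (@derived_subgroup F n) H).
Proof. by move=> gH; elim: k => //= k IH; exact: derived_group. Qed.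

Lemma derived_iter_sub H k :
  mx_subgroup H -> iter k (@derived_subgroup F n) H `<=` H.
Proof.
move=> gH; elim: k => //= k IH.
by apply: subset_trans IH; apply: derived_subW; exact: derived_iter_group.
Qed.

Lemma mx_commJ g h x : g \in unitmx -> h \in unitmx -> x \in unitmx ->
  x *m mx_comm g h *m invmx x =
  mx_comm (x *m g *m invmx x) (x *m h *m invmx x).
Proof.
move=> ug uh ux; rewrite /mx_comm !invmxM ?unitmx_mul ?unitmx_inv ?ug ?uh ?ux //.
by rewrite !invmxK -!mulmxA !(mulKmx ux).
Qed.

Lemma derivedJ H x y : mx_subgroup H -> H x -> derived_subgroup H y ->
  derived_subgroup H (x *m y *m invmx x).
Proof.
move=> gH Hx Dy; have [sH H1 HM HV] := gH; have ux := sH _ Hx.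
have [sD D1 DM DV] := derived_group gH.
suff DJ : derived_subgroup H `<=`
    GL F n `&` [set z | derived_subgroup H (x *m z *m invmx x)].
  by have [] := DJ y Dy.
apply: derived_sub.
  split=> [z []//||g h [ug Dg] [uh Dh]|g [ug Dg]].
  - by split; [exact: unitmx1 | rewrite /= mulmx1 mulmxV].
  - split; first by rewrite /GL /= unitmx_mul; apply/andP.
    by have := DM _ _ Dg Dh; rewrite /= -!mulmxA !(mulKmx ux).
  - split; first by rewrite /GL /= unitmx_inv.
    have := DV _ Dg; rewrite !invmxM ?unitmx_mul ?unitmx_inv ?ug ?ux //.
    by rewrite invmxK mulmxA.
move=> g h Hg Hh; split; first by apply: sH; exact: mx_comm_subgroup.
rewrite /= mx_commJ; [|exact: sH|exact: sH|exact: ux].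
have HJ z : H z -> H (x *m z *m invmx x).
  by move=> Hz; exact: HM (HM _ _ Hx Hz) (HV _ Hx).
by apply: derived_comm; exact: HJ.
Qed.

(** The points joined to 1 by a connected subset of the derived subgroup form
    a subgroup, which contains every commutator because h |-> [g, h] is
    continuous and sends 1 to 1. *)
Lemma derived_connected H : mx_subgroup H -> zconnected H ->
  zconnected (derived_subgroup H).
Proof.
move=> gH Hc; have [sH H1 HM HV] := gH; have gD := derived_group gH.
have [sD D1 DM DV] := gD.
pose J A := [/\ zconnected A, A `<=` derived_subgroup H & A 1%:M].
pose C : set 'M[F]_n := \bigcup_(A in J) A.
have CD : C `<=` derived_subgroup H by move=> x [A [_ AD _] Ax]; exact: AD.
have JT x A : J A -> derived_subgroup H x ->
    zconnected (mulmx x @` A) /\ mulmx x @` A `<=` derived_subgroup H.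
  move=> [Ac AD A1] Dx; split; last by move=> _ [a Aa <-]; apply: DM => //; exact: AD.
  apply: zconnected_image => //; first by move=> a /AD/sD.
  by apply: regular_mxM; [exact: regular_mx_cst | exact: regular_mx_id].
suff DC : derived_subgroup H `<=` C.
  have -> : derived_subgroup H = C by apply/seteqP.
  by apply: bigcup_connected => [|A []//]; exists (1%:M : 'M[F]_n) => A [].
apply: derived_sub; first split.
- by move=> x /CD/sD.
- exists [set 1%:M] => //; split=> //; first exact: connected1.
  by move=> _ ->.
- move=> x y [A JA Ax] [B JB By]; have Dx : derived_subgroup H x by apply: CD; exists A.
  have [Bc BD] := JT x B JB Dx; have [Ac AD A1] := JA; have [_ _ B1] := JB.
  exists (A `|` mulmx x @` B); last by right; exists y.
  split; last by left.
    apply: connectedU => //; exists x; split=> //.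
    by exists 1%:M => //; rewrite mulmx1.
  by move=> z [/AD|/BD].
- move=> x [A JA Ax]; have Dx : derived_subgroup H x by apply: CD; exists A.
  have [Ac AD] := JT (invmx x) A JA (DV _ Dx); have [_ _ A1] := JA.
  exists (mulmx (invmx x) @` A); last by exists 1%:M => //; rewrite mulmx1.
  by split=> //; exists x => //; rewrite mulVmx //; exact: sD.
move=> g h Hg Hh; exists (mx_comm g @` H); last by exists h.
split.
- apply: zconnected_image => //.
  repeat apply: regular_mxM;
    by [exact: regular_mx_cst | exact: regular_mx_id | exact: regular_mxV].
- by move=> _ [k Hk <-]; exact: derived_comm.
- by exists 1%:M => //; rewrite /mx_comm invmx1 !mulmx1 mulVmx //; exact: sH.
Qed.

End FixedSize.

(** A map multiplicative on a group transports it, its derived series and,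
    when regular, its connectedness. *)
Section Image.
Variables (n m : nat) (H : set 'M[F]_n) (rho : 'M[F]_n -> 'M[F]_m).
Hypotheses (gH : mx_subgroup H) (rho1 : rho 1%:M = 1%:M).
Hypothesis rhoM : forall g h, H g -> H h -> rho (g *m h) = rho g *m rho h.

Lemma image_unit g : H g -> rho g \in unitmx /\ invmx (rho g) = rho (invmx g).
Proof.
have [sH H1 HM HV] := gH; move=> Hg; have Hg' := HV _ Hg.
have E : rho g *m rho (invmx g) = 1%:M by rewrite -rhoM // mulmxV ?rho1 //; exact: sH.
have [ug _] := mulmx1_unit E; split=> //.
by apply: (can_inj (mulKmx ug)); rewrite E mulmxV.
Qed.

Lemma image_group_sub K : mx_subgroup K -> K `<=` H -> mx_subgroup (rho @` K).
Proof.
move=> [sK K1 KM KV] KH; split.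
- by move=> _ [g /KH/image_unit[ug _] <-].
- by exists 1%:M.
- move=> _ _ [g Kg <-] [h Kh <-]; exists (g *m h); first exact: KM.
  by rewrite rhoM //; exact: KH.
- move=> _ [g Kg <-]; have [_ ->] := image_unit (KH _ Kg).
  by exists (invmx g) => //; exact: KV.
Qed.

Lemma derived_image K : mx_subgroup K -> K `<=` H ->
  derived_subgroup (rho @` K) `<=` rho @` derived_subgroup K.
Proof.
move=> gK KH; have [sK K1 KM KV] := gK.
apply: derived_sub.
  apply: image_group_sub; first exact: derived_group.
  by apply: subset_trans KH; exact: derived_subW.
move=> _ _ [g Kg <-] [h Kh <-]; exists (mx_comm g h); first exact: derived_comm.
have [Hg Hh] := (KH _ Kg, KH _ Kh); have [_ _ HM HV] := gH.
have [[_ gE] [_ hE]] := (image_unit Hg, image_unit Hh).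
have [Hg' Hh'] := (HV _ Hg, HV _ Hh); have Hgh := HM _ _ Hg' Hh'.
by rewrite /mx_comm !rhoM ?gE ?hE //; exact: HM.
Qed.

Lemma derived_iter_image k :
  iter k (@derived_subgroup F m) (rho @` H) `<=`
  rho @` iter k (@derived_subgroup F n) H.
Proof.
elim: k => //= k IH; apply: subset_trans (derived_mono IH) _.
by apply: derived_image; [exact: derived_iter_group | exact: derived_iter_sub].
Qed.

End Image.
End Derived.

(** * The Lie--Kolchin theorem *)

Section CommonEigenvectors.
Variable F : numClosedFieldType.

(** A subspace that is given by a predicate is the row space of a matrix of
    maximal rank among those whose rows satisfy it. *)
Lemma subspace_mx n (S : 'rV[F]_n -> Prop) :
  S 0 -> (forall a u v, S u -> S v -> S (a *: u + v)) ->
  exists W : 'M[F]_n, forall w : 'rV_n, (w <= W)%MS <-> S w.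
Proof.
move=> S0 SL.
pose Q r := `[< exists2 W : 'M[F]_n, \rank W = r &
  forall w : 'rV_n, (w <= W)%MS -> S w >].
have exQ : exists r, Q r.
  exists 0; apply/asboolP; exists 0; first by rewrite mxrank0.
  by move=> w; rewrite submx0 => /eqP ->.
have Qn r : Q r -> (r <= n)%N by move=> /asboolP[W <- _]; exact: rank_leq_row.
case: (ex_maxnP exQ Qn) => r /asboolP[W Wr WS] rmax.
exists W => w; split=> [/WS//|Sw]; apply: contrapT => /negP wW.
have : Q (\rank (W + w)%MS).
  apply/asboolP; exists (W + w)%MS => // x /sub_addsmxP[[u v] ->] /=.
  rewrite addrC (mx11_scalar v) mul_scalar_mx; apply: SL => //.
  by apply: WS; exact: submxMl.
move/rmax; rewrite -Wr leqNgt -[X in ~~ X]negbK negbK => /negP; apply.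
rewrite ltnNge; apply: contra wW => rk; apply: submx_trans (addsmxSr W w) _.
by rewrite (geq_leqif (mxrank_leqif_sup (addsmxSl W w))) in rk.
Qed.

Lemma stable_eigenvector n (W g : 'M[F]_n) : W != 0 -> (W *m g <= W)%MS ->
  exists v : 'rV_n, [/\ v != 0, (v <= W)%MS & exists a, v *m g = a *: v].
Proof.
move=> W0 Wg; set X := row_base W.
have /submxP[A XA] : (X *m g <= X)%MS.
  by rewrite (eqmxMr g (eq_row_base W)) (submx_trans Wg) // eq_row_base.
have [a] : exists a, root (char_poly A) a.
  apply/closed_rootP; rewrite size_char_poly eqSS.
  by rewrite mxrank_eq0.
rewrite -eigenvalue_root_char => /eigenvalueP[w wA w0]; exists (w *m X); split.
- by rewrite mulmx_free_eq0 // row_base_free.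
- by rewrite (submx_trans (submxMl w X)) // eq_row_base.
- by exists a; rewrite -mulmxA XA mulmxA wA scalemxAl.
Qed.

(** Unless all of S acts by scalars, an eigenspace of some g in S is a smaller
    subspace that is stable because S commutes with g. *)
Lemma commuting_eigenvector n (S : set 'M[F]_n) (W : 'M[F]_n) : W != 0 ->
  (forall g, S g -> (W *m g <= W)%MS) ->
  (forall g h, S g -> S h -> W *m g *m h = W *m h *m g) ->
  exists v : 'rV_n, [/\ v != 0, (v <= W)%MS &
    forall g, S g -> exists a, v *m g = a *: v].
Proof.
move: {2}(\rank W) (leqnn (\rank W)) => k; elim: k W => [|k IH] W.
  by rewrite leqn0 mxrank_eq0 => ->.
move=> rW W0 Ws Wc.
have [sc|] := pselect (forall g, S g -> exists a, W *m g = a *: W).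
  exists (nz_row W); split; rewrite ?nz_row_eq0 ?nz_row_sub // => g /sc[a ga].
  exists a; have /submxP[D ->] := nz_row_sub W.
  by rewrite -mulmxA ga scalemxAr.
move=> /existsNP[g /not_implyP[Sg nsc]].
have [u [u0 uW [a ua]]] := stable_eigenvector W0 (Ws g Sg).
set W' := (W :&: eigenspace g a)%MS.
have W'g : W' *m g = a *: W' by apply/eigenspaceP; exact: capmxSr.
have /submxP[D W'D] : (W' <= W)%MS by exact: capmxSl.
have [||h Sh|x y Sx Sy|v [v0 vW' vS]] := IH W'.
- rewrite -ltnS; apply: leq_trans rW.
  have : (W' <= W)%MS by exact: capmxSl.
  move/mxrank_leqif_sup => [le eq]; rewrite ltn_neqAle le andbT eq.
  apply/negP => WW'; apply: nsc; exists a; apply/eigenspaceP.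
  by apply: submx_trans WW' _; exact: capmxSr.
- apply: contraNneq u0 => W'0; rewrite -submx0 -W'0 sub_capmx uW.
  by apply/eigenspaceP.
- rewrite sub_capmx; apply/andP; split.
    by rewrite W'D -mulmxA mulmx_sub // Ws.
  apply/eigenspaceP; rewrite {1}W'D -(mulmxA D) -(mulmxA D) (Wc h g) // !mulmxA -W'D.
  by rewrite W'g -scalemxAl.
- by rewrite W'D -!(mulmxA D) Wc.
exists v; split=> //; apply: submx_trans vW' _; exact: capmxSl.
Qed.

Lemma mx_commE n (g h : 'M[F]_n) : g \in unitmx -> h \in unitmx ->
  h *m g *m mx_comm g h = g *m h.
Proof. by move=> ug uh; rewrite /mx_comm !mulmxA mulmxK // mulmxV // mul1mx. Qed.

(** By induction the derived subgroup has a common eigenvector, of weight lam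
    say.  Rigidity of eigenvalues along the connected group H shows first that
    H preserves the weight space W, then that commutators act trivially on W,
    so that H acts on W through commuting operators. *)
Lemma lie_kolchin_eigenvector k m (H : set 'M[F]_m) : (0 < m)%N ->
  mx_subgroup H -> zconnected H ->
  iter k (@derived_subgroup F m) H `<=` [set 1%:M] ->
  exists2 v : 'rV_m, v != 0 & forall h, H h -> exists a, v *m h = a *: v.
Proof.
move=> m0; elim: k H => [|k IH] H gH Hc.
  move=> /= H1; exists (const_mx 1).
    by apply/eqP => /rowP/(_ (Ordinal m0))/eqP; rewrite !mxE oner_eq0.
  by move=> h /H1 ->; exists 1; rewrite mulmx1 scale1r.
rewrite iterSr => Hk.
have gD := derived_group gH; have [sH H1 HM HV] := gH; have [sD _ _ _] := gD.
have [v v0 vD] := IH _ gD (derived_connected gH Hc) Hk.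
have [lam lamE] : exists lam : 'M[F]_m -> F,
    forall x, derived_subgroup H x -> v *m x = lam x *: v.
  suff /choice[lam lamE] : forall x, exists a, derived_subgroup H x -> v *m x = a *: v.
    by exists lam.
  move=> x; have [/vD[a xa]|nDx] := pselect (derived_subgroup H x).
    by exists a.
  by exists 0 => /nDx.
pose S (w : 'rV[F]_m) := forall x, derived_subgroup H x -> w *m x = lam x *: w.
have [W WS] : exists W : 'M[F]_m, forall w : 'rV_m, (w <= W)%MS <-> S w.
  apply: subspace_mx => [x _|a u w Su Sw x Dx]; first by rewrite mul0mx scaler0.
  by rewrite mulmxDl -scalemxAl Su // Sw // scalerDr !scalerA mulrC.
have W0 : W != 0.
  by apply: contraNneq v0 => W0; rewrite -submx0 -W0 WS.
have SH w h : S w -> H h -> S (w *m h).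
  move=> Sw Hh x Dx; have [->|w0] := eqVneq w 0; first by rewrite !mul0mx scaler0.
  apply: (zconnected_eigenvalue sH H1 Hc w0) => // [g Hg|]; last exact: Sw.
  exists (lam (g *m x *m invmx g)).
  rewrite scalemxAl -Sw; last exact: derivedJ.
  by rewrite !mulmxA mulmxKV //; exact: sH.
have WH g : H g -> (W *m g <= W)%MS.
  move=> Hg; apply/row_subP => i; rewrite row_mul WS; apply: SH => //.
  by apply/WS; exact: row_sub.
have vc0 x w : x \in unitmx -> w != 0 -> w *m x != 0 :> 'rV[F]_m.
  move=> ux; apply: contraNneq => vx.
  by rewrite -[w](mulmxK ux) vx mul0mx.
have lam1 g h : H g -> H h -> lam (mx_comm g h) = 1.
  move=> Hg Hh; have [ug uh] := (sH _ Hg, sH _ Hh).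
  have lam0 k' : H k' -> lam (mx_comm g k') != 0.
    move=> Hk'; have Dc := derived_comm Hg Hk'.
    have := vc0 _ _ (sD _ Dc) v0; rewrite lamE //.
    by apply: contraNneq => ->; rewrite scale0r.
  have [u [u0 /WS Su [a ua]]] := stable_eigenvector W0 (WH g Hg).
  have uE k' : H k' -> lam (mx_comm g k') *: (u *m k' *m g) = a *: (u *m k').
    move=> Hk'; rewrite -(SH _ g (SH _ k' Su _)) //; last exact: derived_comm.
    by rewrite -!(mulmxA u) mx_commE ?sH // mulmxA ua scalemxAl.
  have := uE h Hh; rewrite (zconnected_eigenvalue sH H1 Hc u0 _ ua Hh).
    have a0 : a != 0.
      by have := vc0 _ _ ug u0; rewrite ua; apply: contraNneq => ->; rewrite scale0r.
    rewrite scalerA => /eqP; rewrite -subr_eq0 -scalerBl scaler_eq0.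
    rewrite (negPf (vc0 _ _ uh u0)) orbF -[X in _ - X]mul1r -mulrBl mulf_eq0.
    by rewrite (negPf a0) orbF subr_eq0 => /eqP.
  move=> k' Hk'; exists ((lam (mx_comm g k'))^-1 * a).
  by rewrite -scalerA -uE // scalerA mulVf ?scale1r ?lam0.
have Wc g h : H g -> H h -> W *m g *m h = W *m h *m g.
  move=> Hg Hh; apply/row_matrixP => i; rewrite !row_mul; set w := row i W.
  have Sw : S w by apply/WS; exact: row_sub.
  have := SH _ g (SH _ h Sw Hh) Hg _ (derived_comm Hg Hh).
  by rewrite lam1 // scale1r -!(mulmxA w) mx_commE ?sH.
have [w [w0 _ wH]] := commuting_eigenvector W0 WH Wc.
by exists w.
Qed.

(** The previous result for the representation of H on the quotient of W by U,
    written in matrices with a basis X of a complement of U in W and a left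
    inverse Y of X that vanishes on U. *)
Lemma lie_kolchin_subquotient n (H : set 'M[F]_n) (U W : 'M[F]_n) :
  mx_subgroup H -> zconnected H -> solvable_subgroup H ->
  (U <= W)%MS -> ~~ (W <= U)%MS ->
  (forall h, H h -> (U *m h <= U)%MS) -> (forall h, H h -> (W *m h <= W)%MS) ->
  exists v : 'rV_n, [/\ (v <= W)%MS, ~~ (v <= U)%MS &
    forall h, H h -> exists a, (v *m h - a *: v <= U)%MS].
Proof.
move=> gH Hc [k Hk] UW WU UH WH; have [sH H1 HM HV] := gH.
set C := (W :\: U)%MS.
have CU : (C :&: U)%MS = 0.
  apply/eqP; rewrite -submx0 -(capmx_diff W U) sub_capmx capmxSr andbT.
  by rewrite capmxSl.
have [X XC Xfree] : exists2 X : 'M_(\rank C, n), (X :=: C)%MS & row_free X.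
  by exists (row_base C); [exact: eq_row_base | exact: row_base_free].
have XW : (X <= W)%MS by rewrite XC diffmxSl.
have WE : (W <= X + U)%MS.
  rewrite (adds_eqmx XC (eqmx_refl U)) -{1}(addsmx_diff_cap_eq W U).
  by rewrite addsmxS // capmxSr.
have [Y UY XY] : exists2 Y : 'M_(n, \rank C),
    forall m' (Z : 'M_(m', n)), (Z <= U)%MS -> Z *m Y = 0 & X *m Y = 1%:M.
  exists (proj_mx C U *m pinvmx X) => [m' Z ZU|]; rewrite mulmxA.
    by rewrite proj_mx_0 ?mul0mx.
  by rewrite proj_mx_id ?XC // mulmxVp.
pose rho h := X *m h *m Y.
have rhoE h : H h -> (X *m h - rho h *m X <= U)%MS.
  move=> Hh; have : (X *m h <= X + U)%MS.
    by apply: submx_trans WE; apply: submx_trans (WH _ Hh); exact: submxMr.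
  move=> /sub_addsmxP[[a b] /= E].
  have -> : rho h = a by rewrite /rho E mulmxDl -mulmxA XY mulmx1 UY ?addr0 ?submxMl.
  by rewrite E addrC addKr submxMl.
have rhoM g h : H g -> H h -> rho (g *m h) = rho g *m rho h.
  move=> Hg Hh; apply/eqP; rewrite -subr_eq0 /rho !mulmxA -mulmxBl -mulmxBl.
  apply/eqP; apply: UY; apply: submx_trans (UH _ Hh); apply: submxMr.
  exact: rhoE.
have rho1 : rho 1%:M = 1%:M by rewrite /rho mulmx1.
have m0 : (0 < \rank C)%N.
  rewrite lt0n mxrank_eq0; apply: contraNneq WU => C0.
  by apply: submx_trans WE _; rewrite addsmx_sub submx_refl andbT XC C0 sub0mx.
have [w w0 wH] : exists2 w : 'rV_(\rank C), w != 0 &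
    forall h, (rho @` H) h -> exists a, w *m h = a *: w.
  apply: (@lie_kolchin_eigenvector k) => //.
  - by apply: (image_group_sub gH rho1 rhoM gH).
  - apply: zconnected_image => //.
    repeat apply: regular_mxM; by [exact: regular_mx_cst|exact: regular_mx_id].
  - by move=> x /(derived_iter_image gH rho1 rhoM); rewrite Hk => -[_ -> <-].
exists (w *m X); split.
- by apply: mulmx_sub.
- apply: contra w0 => /UY; rewrite -mulmxA XY mulmx1 => ->; exact: eqxx.
- move=> h Hh; have [|a aE] := wH (rho h); first by exists h.
  exists a; rewrite scalemxAl -aE -(mulmxA w X) -(mulmxA w (rho h)) -mulmxBr.
  by apply: mulmx_sub; exact: rhoE.
Qed.

End CommonEigenvectors.

(** * Polynomials in a matrix *)

Section PolynomialsInAMatrix.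
Variables (F : fieldType) (n : nat).
Implicit Types (A B : 'M[F]_n) (S : set 'M[F]_n).

Definition mx_subspace S :=
  S 1%:M /\ forall a A B, S A -> S B -> S (a *: A + B).

Definition mx_subalgebra S :=
  mx_subspace S /\ forall A B, S A -> S B -> S (A *m B).

(** The algebra F[A], as an intersection: this covers dimension 0, where
    matrices do not form a nontrivial ring, and it lets properties of
    polynomials in A be proved without multiplying two of them. *)
Definition poly_in A : set 'M[F]_n :=
  smallest (fun S => mx_subspace S /\ forall B, S B -> S (B *m A)) set0.

Lemma poly_in_ind A S : mx_subspace S -> (forall B, S B -> S (B *m A)) ->
  poly_in A `<=` S.
Proof. by move=> S1 SA; apply: smallest_sub. Qed.

Lemma poly_in_subalgebra S A : mx_subalgebra S -> S A -> poly_in A `<=` S.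
Proof. by move=> [S1 SM] SA; apply: poly_in_ind => // B SB; exact: SM. Qed.

End PolynomialsInAMatrix.

Lemma poly_in_horner (F : fieldType) n (A : 'M[F]_n.+1) p : poly_in A (horner_mx A p).
Proof.
move=> S [[[S1 SL] SA] _]; have S0 : S 0.
  by have := SL (- 1) _ _ S1 S1; rewrite scaleN1r addNr.
elim/poly_ind: p => [|p c IH]; first by rewrite raddf0.
rewrite rmorphD rmorphM /= horner_mx_X horner_mx_C addrC -scalemx1.
by apply: SL => //; exact: SA.
Qed.

(** By the Cayley--Hamilton theorem, the constant term of the characteristic
    polynomial being nonzero. *)
Lemma poly_in_invmx (F : fieldType) n (A : 'M[F]_n) :
  A \in unitmx -> poly_in A (invmx A).
Proof.
case: n A => [|n] A uA.
  have -> : invmx A = 1%:M by rewrite [LHS]flatmx0 [RHS]flatmx0.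
  by move=> S [[[]]].
set p := char_poly A.
have p0 : p.[0] != 0.
  apply/eqP => /eqP; rewrite -[_ == 0]/(root p 0) -eigenvalue_root_char.
  move/eigenvalueP => [v vA]; rewrite -[v](mulmxK uA) vA scale0r mul0mx.
  by rewrite eqxx.
have /factor_theorem[q qE] : root (p - p.[0]%:P) 0.
  by rewrite /root !hornerE subrr.
have E : horner_mx A q *m A = - (p.[0])%:M.
  have := congr1 (horner_mx A) qE; rewrite rmorphB rmorphM /= Cayley_Hamilton.
  by rewrite subr0 horner_mx_X horner_mx_C sub0r.
have -> : invmx A = horner_mx A (- (p.[0])^-1%:P * q).
  apply: (can_inj (mulmxK uA)); rewrite mulVmx // rmorphM /= rmorphN /= horner_mx_C.
  by rewrite -mulmxA E mulNmx mulmxN opprK -scalar_mxM mulVf.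
exact: poly_in_horner.
Qed.

(** The square root of X is lifted one root at a time: if q divides
    p ^ 2 - X, a suitable p + c q works modulo q * (X - a).  When a is already
    a root of q the correction is a linear equation with slope 2 p(a), and
    p(a) ^ 2 = a is nonzero. *)
Lemma sqrt_modulo_split (F : numClosedFieldType) (rs : seq F) : 0 \notin rs ->
  exists p, exists r, p ^+ 2 - 'X = (\prod_(a <- rs) ('X - a%:P)) * r.
Proof.
elim: rs => [|a rs IH].
  by exists 0; exists (0 - 'X); rewrite big_nil mul1r expr0n.
rewrite inE negb_or eq_sym => /andP[a0 /IH[p [r pr]]].
rewrite big_cons; set q := \prod_(_ <- rs) _ in pr *.
have lift c : r.[a] + (c * p.[a] + c * p.[a] + c * c * q.[a]) = 0 ->
    exists p', exists r', p' ^+ 2 - 'X = ('X - a%:P) * q * r'.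
  move=> ca; exists (p + c%:P * q).
  have /factor_theorem[r' r'E] : root (r + (c%:P * p + c%:P * p + c%:P * c%:P * q)) a.
    by rewrite /root !(hornerD, hornerM, hornerC) ca.
  exists r'; rewrite mulrAC [_ * r']mulrC -r'E mulrDl [r * q]mulrC -pr; ring.
have pa2 : p.[a] ^+ 2 - a = q.[a] * r.[a].
  by have := congr1 (horner^~ a) pr; rewrite !hornerE.
have [qa|qa] := eqVneq q.[a] 0.
  have pa : p.[a] != 0.
    apply: contraNneq a0 => pa; move: pa2; rewrite pa qa mul0r expr0n /= sub0r.
    by move/eqP; rewrite oppr_eq0.
  apply: (lift (- r.[a] / (2%:R * p.[a]))); rewrite qa; field.
  by rewrite pa.
have [s sa] : exists s : F, s ^+ 2 = a.
  by exists (Num.Theory.sqrtC a); exact: Num.Theory.sqrtCK.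
(* p + c q takes the value s at a *)
apply: (lift ((s - p.[a]) / q.[a])); apply: (mulfI qa).
rewrite mulr0 mulrDr -pa2 -sa; field.
by rewrite sa.
Qed.

Lemma poly_in_sqrt (F : numClosedFieldType) n (A : 'M[F]_n) : A \in unitmx ->
  exists2 f, poly_in A f & A = f *m f.
Proof.
case: n A => [|n] A uA.
  by exists 1%:M; [move=> S [[[S1 _] _] _] | rewrite flatmx0 [RHS]flatmx0].
have [rs rsE] := closed_field_poly_normal (char_poly A).
rewrite (monicP (char_poly_monic A)) scale1r in rsE.
have rs0 : 0 \notin rs.
  apply/negP => rs0; have : root (char_poly A) 0 by rewrite rsE root_prod_XsubC.
  rewrite -eigenvalue_root_char => /eigenvalueP[v vA].
  by rewrite -[v](mulmxK uA) vA scale0r mul0mx eqxx.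
have [p [r pr]] := sqrt_modulo_split rs0.
exists (horner_mx A p); first exact: poly_in_horner.
have := congr1 (horner_mx A) pr.
rewrite -rsE rmorphM /= Cayley_Hamilton mul0r rmorphB /= horner_mx_X rmorphXn /= expr2.
by move/eqP; rewrite subr_eq0 eq_sym => /eqP.
Qed.


(** * Triangular groups and Borel subgroups *)

Section Subalgebras.
Variables (F : fieldType) (n : nat).
Implicit Types (A B : 'M[F]_n) (S : set 'M[F]_n).

(** Inverses stay in a subalgebra because they are polynomials. *)
Lemma units_subgroup S : mx_subalgebra S -> mx_subgroup (GL F n `&` S).
Proof.
move=> aS; have [[S1 SL] SM] := aS; split=> [x []//||A B [uA SA] [uB SB]|A [uA SA]].
- by split=> //; exact: unitmx1.
- by split; [rewrite /GL /= unitmx_mul; apply/andP | exact: SM].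
- split; first by rewrite /GL /= unitmx_inv.
  exact: (poly_in_subalgebra aS SA (poly_in_invmx uA)).
Qed.

(** Incidence algebra of a relation on the indices. *)
Definition incidence (r : rel 'I_n) : set 'M[F]_n :=
  [set A | forall i j, ~~ r i j -> A i j = 0].

Lemma incidenceD r a A B : incidence r A -> incidence r B -> incidence r (a *: A + B).
Proof. by move=> rA rB i j rij; rewrite !mxE rA // rB // mulr0 addr0. Qed.

Lemma incidence1 r : reflexive r -> incidence r 1%:M.
Proof.
by move=> rr i j rij; rewrite mxE; case: eqVneq => // ij; rewrite ij rr in rij.
Qed.

Lemma incidence_subspace r : reflexive r -> mx_subspace (incidence r).
Proof. by split; [exact: incidence1 | move=> a A B; exact: incidenceD]. Qed.

Lemma incidence_subalgebra r : reflexive r -> transitive r ->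
  mx_subalgebra (incidence r).
Proof.
move=> rr rt; split; first exact: incidence_subspace.
move=> A B rA rB i j rij; rewrite mxE big1 // => k _.
have [ik|ik] := boolP (r i k); last by rewrite rA ?mul0r.
have [kj|kj] := boolP (r k j); last by rewrite rB ?mulr0.
by rewrite (rt _ _ _ ik kj) in rij.
Qed.

Lemma incidence_mono (r r' : rel 'I_n) : (forall i j, r i j -> r' i j) ->
  incidence r `<=` incidence r'.
Proof. by move=> rr' A rA i j ij; apply: rA; apply: contra ij; exact: rr'. Qed.

End Subalgebras.

Section TriangularGroup.
Variables (F : numFieldType) (n : nat) (c : 'I_n -> F).
Implicit Types A B : 'M[F]_n.

(** Indices are coloured by c: the incidence algebra of equality of colours is
    the centraliser of the diagonal matrix with entries c. *)
Definition same_colour : rel 'I_n := fun i j => c i == c j.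
Definition colour_le : rel 'I_n := fun i j => (i <= j)%N && (c i == c j).

Lemma colour_le_refl : reflexive colour_le.
Proof. by move=> i; rewrite /colour_le leqnn eqxx. Qed.

Lemma colour_le_trans : transitive colour_le.
Proof.
move=> j i k /andP[ij /eqP cij] /andP[jk /eqP cjk].
by rewrite /colour_le (leq_trans ij jk) cij cjk eqxx.
Qed.

Definition triangular_group : set 'M[F]_n := GL F n `&` incidence colour_le.

Lemma triangular_subgroup : mx_subgroup triangular_group.
Proof.
apply: units_subgroup; apply: incidence_subalgebra.
  exact: colour_le_refl.
exact: colour_le_trans.
Qed.

Lemma triangular_connected : zconnected triangular_group.
Proof.
apply: zconnected_units; first exact: incidence1 colour_le_refl.
move=> A s tA; rewrite addrC; apply: incidenceD; last exact: incidence1 colour_le_refl.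
rewrite addrC -scaleN1r; apply: incidenceD => //; exact: incidence1 colour_le_refl.
Qed.

Definition band k : set 'M[F]_n := incidence (fun i j => (i + k <= j)%N).

Lemma bandM k l A B : band k A -> band l B -> band (k + l) (A *m B).
Proof.
move=> kA lB i j ij; rewrite mxE big1 // => m _.
have [im|im] := leqP (i + k) m; last by rewrite kA ?mul0r // -ltnNge.
have [mj|mj] := leqP (m + l) j; last by rewrite lB ?mulr0 // -ltnNge.
by case/negP: ij; rewrite addnA; apply: leq_trans mj; rewrite leq_add2r.
Qed.

Lemma bandW k l A : (k <= l)%N -> band l A -> band k A.
Proof.
move=> kl; apply: incidence_mono => i j; apply: leq_trans; by rewrite leq_add2l.
Qed.

Lemma band0 A : incidence colour_le A -> band 0 A.
Proof. by apply: incidence_mono => i j /andP[]; rewrite addn0. Qed.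

Lemma band_commutator A B :
  incidence colour_le A -> incidence colour_le B -> band 1 (A *m B - B *m A).
Proof.
move=> /band0 A0 /band0 B0 i j; rewrite addn1 -leqNgt => ji.
have diag (X Y : 'M[F]_n) : band 0 X -> band 0 Y ->
    (X *m Y) i j = (X i j * Y i j) *+ (i == j).
  move=> X0 Y0; case: eqVneq => [ij|ij].
    rewrite -ij mxE (bigD1 i) //= big1 ?addr0 // => k ki.
    have [ik|ik] := leqP i k; last by rewrite X0 ?mul0r // addn0 -ltnNge.
    rewrite Y0 ?mulr0 // addn0 -ltnNge ltn_neqAle ik andbT.
    by apply: contra ki => /eqP/val_inj ->.
  apply: (bandM X0 Y0); rewrite !addn0 -ltnNge ltn_neqAle ji andbT.
  by apply: contra ij => /eqP/val_inj ->.
rewrite mxE [X in _ + X]mxE !diag //; first by rewrite mulrC subrr.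
Qed.

Definition unipotent_group k : set 'M[F]_n :=
  triangular_group `&` [set A | band k (A - 1%:M)].

Lemma unipotent_subgroup k : mx_subgroup (unipotent_group k).
Proof.
have [sT T1 TM TV] := triangular_subgroup.
split=> [A [/sT]//||A B [TA kA] [TB kB]|A [TA kA]].
- by split=> //= i j _; rewrite subrr mxE.
- split; first exact: TM.
  rewrite /=; have -> : A *m B - 1%:M = 1 *: ((A - 1%:M) *m B) + (B - 1%:M).
    by rewrite scale1r mulmxBl mul1mx addrA subrK.
  apply: incidenceD => //; rewrite -[k]addn0; apply: bandM => //.
  by apply: band0; case: TB.
- split; first exact: TV.
  rewrite /=; have -> : invmx A - 1%:M = (-1) *: (invmx A *m (A - 1%:M)) + 0.
    by rewrite addr0 mulmxBr mulmx1 mulVmx ?sT // scaleN1r opprB.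
  apply: incidenceD; last by move=> i j _; rewrite mxE.
  rewrite -[k]add0n; apply: bandM => //; apply: band0.
  by have [] := TV _ TA.
Qed.

(** A commutator minus 1 is a multiple of A B - B A, which for k > 0 is also
    the additive commutator of A - 1 and B - 1, of band 2 k; for k = 0 one
    diagonal is gained because diagonal entries commute. *)
Lemma unipotent_derived k :
  derived_subgroup (unipotent_group k) `<=` unipotent_group k.+1.
Proof.
have gT := triangular_subgroup; have [sT T1 TM TV] := gT.
apply: derived_sub; first exact: unipotent_subgroup.
move=> A B [TA kA] [TB kB]; have TC := mx_comm_subgroup gT TA TB.
split=> //=; have [uA uB] := (sT _ TA, sT _ TB).
have -> : mx_comm A B - 1%:M = invmx A *m invmx B *m (A *m B - B *m A).
  by rewrite mulmxBr /mx_comm !mulmxA (mulmxKV uB) mulVmx.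
rewrite -[k.+1]add0n; apply: bandM.
  by apply: band0; have [] := TM _ _ (TV _ TA) (TV _ TB).
case: k kA kB => [|k] kA kB.
  by apply: band_commutator; [case: TA | case: TB].
have -> : A *m B - B *m A =
    (-1) *: ((B - 1%:M) *m (A - 1%:M)) + (A - 1%:M) *m (B - 1%:M).
  rewrite !mulmxBl !mulmxBr !mul1mx !mulmx1; move: (A *m B) (B *m A) => X Y.
  by apply/matrixP => i j; rewrite !mxE; ring.
have kk : (k.+2 <= k.+1 + k.+1)%N by rewrite addSnnS leq_addl.
by apply: incidenceD; apply: bandW kk _; apply: bandM.
Qed.

Lemma triangular_solvable :
  iter n (@derived_subgroup F n) triangular_group = [set 1%:M].
Proof.
apply/seteqP; split=> [A|A ->]; last first.
  by have [] := derived_iter_group n triangular_subgroup.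
have sub k : iter k (@derived_subgroup F n) triangular_group `<=` unipotent_group k.
  elim: k => [B [uB tB]|k IH].
    split=> //=; rewrite addrC -scaleN1r; apply: band0.
    by apply: incidenceD => //; exact: incidence1 colour_le_refl.
  by move=> B /= DB; apply: unipotent_derived; exact: derived_mono IH _ DB.
move=> /sub [_ An] /=; apply/eqP; rewrite -subr_eq0; apply/eqP/matrixP => i j.
by rewrite [RHS]mxE An // -ltnNge; apply: leq_trans (ltn_ord j) _; rewrite leq_addl.
Qed.

End TriangularGroup.

Section AdaptedBasis.
Variable F : numClosedFieldType.

(** Diagonalisability of I, in the form that serves to extend a partial basis
    of eigenvectors. *)
Definition eigenspaces_span n (I : 'M[F]_n) := forall U : 'M[F]_n, ~~ row_full U ->
  exists a, exists2 v : 'rV_n, v *m I = a *: v & ~~ (v <= U)%MS.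

(** The rows of g are chosen from the last to the first.  If those already
    chosen span X, some eigenspace W of I is not contained in X; H preserves it
    as it commutes with I, and the Lie--Kolchin theorem for W modulo its
    intersection with X supplies the next row, again an eigenvector of I. *)
Lemma adapted_basis n (I : 'M[F]_n) (H : set 'M[F]_n) :
  eigenspaces_span I -> (forall h, H h -> h *m I = I *m h) ->
  mx_subgroup H -> zconnected H -> solvable_subgroup H ->
  exists2 g, g \in unitmx & exists c : 'I_n -> F,
    (forall i, row i g *m I = c i *: row i g) /\
    forall h, H h -> forall i j : 'I_n, (j < i)%N -> (g *m h *m invmx g) i j = 0.
Proof.
move=> Isp HI gH Hc Hsol.
suff ex k : (k <= n)%N -> exists X : 'M[F]_(k, n), [/\ row_free X,
    forall i, exists a, row i X *m I = a *: row i X &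
    forall h, H h -> exists2 T : 'M_k, X *m h = T *m X &
      forall i j : 'I_k, (j < i)%N -> T i j = 0].
  have [g [gf gI gT]] := ex n (leqnn n).
  have ug : g \in unitmx by rewrite -row_free_unit.
  exists g => //; have [c cE] := choice gI; exists c; split=> // h /gT[T hT TT] i j.
  by rewrite hT mulmxK //; exact: TT.
elim: k => [_|k IH kn].
  exists 0; split; rewrite /row_free ?mxrank0 //; first by case.
  by move=> h _; exists 0; [rewrite !mul0mx | case].
have [X [Xf XI XT]] := IH (ltnW kn).
have XU : (X :=: <<X>>)%MS by exact/eqmx_sym/genmxE.
have [|a [v0 v0I v0U]] := Isp <<X>>%MS.
  by rewrite /row_full mxrank_gen; move: Xf => /eqP ->; rewrite ltn_eqF.
set W := eigenspace I a; set U := (W :&: <<X>>)%MS.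
have v0W : (v0 <= W)%MS by apply/eigenspaceP.
have XH h : H h -> (<<X>> *m h <= <<X>>)%MS.
  move=> /XT[T hT _]; rewrite -(eqmxMr h XU) hT -XU; exact: submxMl.
have WH h : H h -> (W *m h <= W)%MS.
  move=> Hh; apply/eigenspaceP; rewrite -mulmxA HI // mulmxA.
  by rewrite (eigenspaceP (submx_refl W)) -scalemxAl.
have [||h Hh||v [vW vU vH]] := @lie_kolchin_subquotient F n H U W gH Hc Hsol.
- exact: capmxSl.
- apply: contra v0U => WU; apply: submx_trans v0W (submx_trans WU _).
  exact: capmxSr.
- rewrite sub_capmx; apply/andP; split.
    by apply: submx_trans (WH h Hh); apply: submxMr; exact: capmxSl.
  by apply: submx_trans (XH h Hh); apply: submxMr; exact: capmxSr.
- exact: WH.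
have vX : ~~ (v <= X)%MS by apply: contra vU => vX; rewrite sub_capmx vW -XU.
have X'I (i : 'I_(1 + k)) :
    exists a, row i (col_mx v X) *m I = a *: row i (col_mx v X).
  case: (split_ordP i) => j ->.
    rewrite rowKu; exists a; apply/eigenspaceP; apply: submx_trans vW.
    exact: row_sub.
  by rewrite rowKd; exact: XI.
have X'T h : H h -> exists2 T : 'M_(1 + k), col_mx v X *m h = T *m col_mx v X &
    forall i j : 'I_(1 + k), (j < i)%N -> T i j = 0.
  move=> Hh; have [b bU] := vH h Hh; have [T hT TT] := XT h Hh.
  have /submxP[w wE] : (v *m h - b *: v <= X)%MS.
    by rewrite XU; apply: submx_trans bU _; exact: capmxSr.
  exists (block_mx b%:M w 0 T).
    rewrite mul_col_mx mul_block_col mul0mx add0r -hT -wE mul_scalar_mx.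
    by rewrite addrC subrK.
  move=> i j; case: (split_ordP i) => i' ->; case: (split_ordP j) => j' ->.
  - by rewrite !ord1.
  - by rewrite /= ord1.
  - by rewrite block_mxEdl mxE.
  - by rewrite block_mxEdr /= ltn_add2l; exact: TT.
exists (col_mx v X : 'M_(1 + k, n)); split=> //.
rewrite /row_free eqn_leq rank_leq_row andTb; have [<- _] := addsmxE v X.
suff : (\rank X < \rank (v + X)%MS)%N by rewrite (eqP Xf).
have [le eq] := mxrank_leqif_sup (addsmxSr v X).
rewrite ltn_neqAle le andbT eq.
by apply: contra vX; apply: submx_trans; exact: addsmxSl.
Qed.

End AdaptedBasis.

(** * Overgroups of a triangular group *)

Section Overgroups.
Variables (F : numFieldType) (n : nat).
Implicit Types (A B M : 'M[F]_n) (P : set 'M[F]_n) (w : {perm 'I_n}).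

Definition transvection (t : F) (a b : 'I_n) : 'M[F]_n := 1%:M + t *: delta_mx a b.

Lemma mul_deltal (a b : 'I_n) M i j : (delta_mx a b *m M) i j = (i == a)%:R * M b j.
Proof.
rewrite mxE (bigD1 b) //= big1 ?addr0; first by rewrite mxE eqxx andbT.
by move=> k /negPf kb; rewrite mxE kb andbF mul0r.
Qed.

Lemma mul_deltar (a b : 'I_n) M i j : (M *m delta_mx a b) i j = M i a * (j == b)%:R.
Proof.
rewrite mxE (bigD1 a) //= big1 ?addr0; first by rewrite mxE eqxx.
by move=> k /negPf ka; rewrite mxE ka mulr0.
Qed.

Lemma transvectionl t a b M i j :
  (transvection t a b *m M) i j = M i j + t * (i == a)%:R * M b j.
Proof.
by rewrite mulmxDl mul1mx -scalemxAl mxE [in X in _ + X]mxE mul_deltal mulrA.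
Qed.

Lemma transvectionV t a b : a != b ->
  transvection t a b *m transvection (- t) a b = 1%:M.
Proof.
move=> ab; rewrite mulmxDl mul1mx mulmxDr mulmx1 -scalemxAl -scalemxAr.
rewrite mul_delta_mx_0 1?eq_sym // !scaler0 addr0 -addrA -scalerDl addNr.
by rewrite scale0r addr0.
Qed.

Lemma unit_col_neq0 M k : M \in unitmx -> exists i, M i k != 0.
Proof.
move=> uM; apply: contrapT => nM.
have Mk i : M i k = 0 by apply: contrapT => /eqP Mik; apply: nM; exists i.
suff : (delta_mx k k : 'M[F]_n) = 0.
  by move/matrixP/(_ k k)/eqP; rewrite !mxE !eqxx oner_eq0.
apply: (can_inj (mulKmx uM)); rewrite mulmx0; apply/matrixP => i j.
by rewrite mul_deltar Mk mul0r mxE.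
Qed.

Section Bruhat.
Variable c : 'I_n -> F.

Local Notation T := (triangular_group c).

Lemma triangular_transvection t (a b : 'I_n) :
  (a < b)%N -> c a = c b -> T (transvection t a b).
Proof.
move=> ab cab; have nab : a != b by rewrite neq_ltn ab.
split; first by case: (mulmx1_unit (transvectionV t nab)).
rewrite /transvection addrC; apply: incidenceD; last exact: incidence1 (colour_le_refl c).
move=> i j; rewrite mxE; case: eqVneq => [->|//]; case: eqVneq => [->|//].
by rewrite /colour_le (ltnW ab) cab eqxx.
Qed.

Lemma triangular_same_colour A : T A -> incidence (same_colour c) A.
Proof. by move=> [_]; apply: incidence_mono => i j /andP[]. Qed.

Lemma same_colour_subalgebra : mx_subalgebra (incidence (F := F) (same_colour c)).
Proof.
by apply: incidence_subalgebra => [i|j i k]; rewrite /same_colour ?eqxx // => /eqP ->.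
Qed.

Lemma triangular_rank1 (u : 'cV[F]_n) (v : 'rV[F]_n) : v *m u = 0 ->
  (forall i j, ~~ colour_le c i j -> u i 0 * v 0 j = 0) -> T (1%:M + u *m v).
Proof.
move=> vu uv; split.
  suff E : (1%:M + u *m v) *m (1%:M - u *m v) = 1%:M by case: (mulmx1_unit E).
  rewrite mulmxDl mul1mx mulmxBr mulmx1 -mulmxA (mulmxA v) vu mul0mx mulmx0 subr0.
  by rewrite subrK.
rewrite addrC -[u *m v]scale1r; apply: incidenceD; last exact: incidence1 (colour_le_refl c).
by move=> i j ij; rewrite mxE big_ord1 uv.
Qed.

(** The first k columns are monomial, and so are the rows of their pivots. *)
Definition cleared k M := forall j : 'I_n, (j < k)%N -> exists i,
  (forall a, a != i -> M a j = 0) /\ (forall b, b != j -> M i b = 0).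

(** The pivot of column k is its lowest nonzero entry.  The pivot row is used
    to clear the column above it, by a row operation that is upper triangular
    as it adds a row to higher ones, then the column is used to clear the pivot
    row to its right. *)
Lemma clear_column (k : 'I_n) M : M \in unitmx -> incidence (same_colour c) M ->
  cleared k M -> exists2 L, T L & exists2 R, T R & cleared k.+1 (L *m M *m R).
Proof.
move=> uM cM clM; have [i0 Mi0] := unit_col_neq0 k uM.
case: (@arg_maxnP _ i0 (fun i => M i k != 0) (fun i => i) Mi0) => i Mik imax.
have colik j : M j k != 0 -> c j = c k.
  by move=> Mjk; apply/eqP; apply: contraNT Mjk => jk; rewrite cM.
have below (a : 'I_n) : (i < a)%N -> M a k = 0.
  by move=> ia; apply: contrapT => /eqP/imax; rewrite /geq /= leqNgt ia.
have Mi_lt (j : 'I_n) : (j < k)%N -> M i j = 0.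
  move=> jk; have [i' [colj rowi']] := clM j jk.
  have [ii'|] := eqVneq i i'; last exact: colj.
  by rewrite -ii' in rowi'; rewrite rowi' ?eqxx // neq_ltn jk orbT in Mik.
pose u : 'cV[F]_n := \col_a (if (a < i)%N then - (M a k / M i k) else 0).
pose r : 'rV[F]_n := \row_b (if (k < b)%N then - (M i b / M i k) else 0).
pose L : 'M[F]_n := 1%:M + u *m delta_mx 0 i.
pose R : 'M[F]_n := 1%:M + delta_mx k 0 *m r.
have LE a b : (L *m M) a b = M a b + u a 0 * M i b.
  rewrite mulmxDl mul1mx -mulmxA -rowE mxE; congr (_ + _).
  by rewrite mxE big_ord1 [row _ _ _ _]mxE.
have RE N a b : (N *m R) a b = N a b + N a k * r 0 b.
  rewrite mulmxDr mulmx1 mulmxA -colE mxE; congr (_ + _).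
  by rewrite mxE big_ord1 [col _ _ _ _]mxE.
have ui : u i 0 = 0 by rewrite mxE ltnn.
have uMi (a : 'I_n) : (a < i)%N -> u a 0 * M i k = - M a k.
  by move=> ai; rewrite mxE ai mulNr divfK.
have rMi (b : 'I_n) : (k < b)%N -> M i k * r 0 b = - M i b.
  by move=> kb; rewrite mxE kb mulrN mulrC divfK.
have LMi b : (L *m M) i b = M i b by rewrite LE ui mul0r addr0.
have LMk a : a != i -> (L *m M) a k = 0.
  rewrite LE neq_ltn => /orP[ai|ia]; first by rewrite uMi // subrr.
  by rewrite below // add0r mxE ltnNge (ltnW ia) mul0r.
exists L; last exists R.
- apply: triangular_rank1 => [|a b].
    by rewrite -rowE; apply/rowP => z; rewrite !mxE ltnn.
  rewrite !mxE eqxx /=; case: eqVneq => [->|]; last by rewrite mulr0.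
  case: ltnP => ai; last by rewrite mul0r.
  rewrite /colour_le (ltnW ai) /=; have [->|Mak] := eqVneq (M a k) 0.
    by rewrite mul0r oppr0 mul0r.
  by rewrite (colik _ Mak) (colik _ Mik) eqxx.
- apply: triangular_rank1 => [|a b].
    by rewrite -colE; apply/colP => z; rewrite !mxE ltnn.
  rewrite !mxE eqxx andbT; case: eqVneq => [->|]; last by rewrite mul0r.
  case: ltnP => kb; last by rewrite mulr0.
  rewrite /colour_le (ltnW kb) /= => ckb; rewrite cM ?mul0r ?oppr0 ?mulr0 //.
  by rewrite /same_colour (colik _ Mik).
move=> j; rewrite ltnS leq_eqVlt => /orP[/eqP/val_inj->|jk].
  exists i; split=> [a ai|b bk]; rewrite RE ?LMi.
    by rewrite LMk // mul0r addr0.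
  move: bk; rewrite neq_ltn => /orP[bk|kb]; last by rewrite rMi // subrr.
  by rewrite Mi_lt // add0r mxE ltnNge (ltnW bk) mulr0.
have nkj : k != j by rewrite neq_ltn jk orbT.
have [i' [colj rowi']] := clM j jk; exists i'; split=> [a ai'|b bj]; rewrite RE LE.
  rewrite colj // Mi_lt // mulr0 !add0r.
  by rewrite [r _ _]mxE ltnNge (ltnW jk) mulr0.
have ui' : u i' 0 = 0 by rewrite mxE rowi' // mul0r oppr0 if_same.
by rewrite rowi' // LE ui' rowi' // !(mul0r, addr0).
Qed.

Definition monomial w M := forall i j, i != w j -> M i j = 0.

(** Existence part of the Bruhat decomposition. *)
Lemma bruhat A : A \in unitmx -> incidence (same_colour c) A ->
  exists2 L, T L & exists2 R, T R & exists w, monomial w (L *m A *m R).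
Proof.
move=> uA cA; have gT := triangular_subgroup c; have [sT T1 TM _] := gT.
have sc := same_colour_subalgebra.
have cLR L R : T L -> T R ->
    L *m A *m R \in unitmx /\ incidence (same_colour c) (L *m A *m R).
  move=> TL TR; have [_ SM] := sc; split.
    by rewrite !unitmx_mul uA !andbT; apply/andP; split; exact: sT.
  by apply: (SM); [apply: (SM)|]; rewrite //; exact: triangular_same_colour.
have ex k : (k <= n)%N -> exists2 L, T L & exists2 R, T R & cleared k (L *m A *m R).
  elim: k => [_|k IH kn]; first by exists 1%:M => //; exists 1%:M.
  have [L TL [R TR cl]] := IH (ltnW kn).
  have [uM cM] := cLR L R TL TR.
  have [L' TL' [R' TR' cl']] := @clear_column (Ordinal kn) _ uM cM cl.
  exists (L' *m L); first exact: TM.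
  exists (R *m R'); first exact: TM.
  by rewrite !mulmxA in cl' *.
have [L TL [R TR cl]] := ex n (leqnn n); exists L => //; exists R => //.
have [uM _] := cLR L R TL TR; move: (L *m A *m R) uM cl => M uM cl.
have [f fE] := choice (fun j => cl j (ltn_ord j)).
have finj : injective f.
  move=> j j' fjj'; apply: contrapT => /eqP jj'.
  have [i Mij'] := unit_col_neq0 j' uM; case/eqP: Mij'.
  have [iE|] := eqVneq i (f j'); last by apply: (fE j').1.
  by rewrite iE -fjj'; apply: (fE j).2; rewrite eq_sym.
by exists (perm finj) => i j; rewrite permE; apply: (fE j).1.
Qed.

End Bruhat.

Lemma monomial_neq0 w M j : M \in unitmx -> monomial w M -> M (w j) j != 0.
Proof.
move=> uM wM; have [i Mij] := unit_col_neq0 j uM.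
by have [<-//|iw] := eqVneq i (w j); rewrite wM ?eqxx in Mij.
Qed.

Section Saturation.
Variables (c : 'I_n -> F) (P : set 'M[F]_n).
Hypotheses (gP : mx_subgroup P) (TP : triangular_group c `<=` P).
Hypothesis Pc : P `<=` incidence (same_colour c).

(** The positions (i, j) of the root subgroups 1 + t E_ij contained in P. *)
Definition root_rel : rel 'I_n :=
  fun i j => (i == j) || `[< forall t, P (transvection t i j) >].

Lemma root_relP i j : i != j -> root_rel i j -> forall t, P (transvection t i j).
Proof. by rewrite /root_rel => /negPf -> /= /asboolP. Qed.

Lemma root_rel_refl : reflexive root_rel.
Proof. by move=> i; rewrite /root_rel eqxx. Qed.

(** The commutator of transvections at (i, j) and (j, k) is one at (i, k). *)
Lemma root_rel_trans : transitive root_rel.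
Proof.
move=> j i k; have [->//|ij] := eqVneq i j; have [->//|jk] := eqVneq j k.
move=> /(root_relP ij) Pij /(root_relP jk) Pjk.
rewrite /root_rel; case: eqVneq => //= ik; apply/asboolP => t.
have [_ _ PM _] := gP.
have -> : transvection t i k = transvection t i j *m transvection 1 j k *m
    (transvection (- t) i j *m transvection (- 1) j k).
  apply/matrixP => a b; rewrite -!mulmxA !transvectionl /transvection !mxE.
  rewrite -!mulnb !natrM !eqxx [j == i]eq_sym [k == i]eq_sym [k == j]eq_sym.
  rewrite [k == b]eq_sym (negPf ij) (negPf jk) (negPf ik).
  by rewrite /=; ring.
by do ![apply: (PM)].
Qed.

Lemma colour_le_root i j : colour_le c i j -> root_rel i j.
Proof.
rewrite /colour_le leq_eqVlt => /andP[/orP[/eqP/val_inj->|ij] /eqP cij].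
  exact: root_rel_refl.
apply/orP; right; apply/asboolP => t; apply: TP.
exact: triangular_transvection.
Qed.

Lemma root_rel_colour i j : root_rel i j -> c i = c j.
Proof.
have [->//|ij] := eqVneq i j => /(root_relP ij)/(_ 1)/Pc/(_ i j) E.
apply/eqP; apply: contraT => /E/eqP.
by rewrite !mxE (negPf ij) !eqxx add0r mulr1 oner_eq0.
Qed.

(** Conjugation by a monomial matrix permutes the root subgroups. *)
Lemma root_rel_monomial w M a b : P M -> monomial w M ->
  root_rel a b -> root_rel (w a) (w b).
Proof.
move=> PM wM; have [->|ab] := eqVneq a b; first by move=> _; exact: root_rel_refl.
move=> /(root_relP ab) Pab; apply/orP; right; apply/asboolP => t.
have [sP _ PMM PV] := gP; have uM := sP _ PM.
have [Ma Mb] := (monomial_neq0 a uM wM, monomial_neq0 b uM wM).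
pose s := t * M (w b) b / M (w a) a.
suff E : M *m transvection s a b = transvection t (w a) (w b) *m M.
  rewrite -[transvection t _ _](mulmxK uM) -E; apply: (PMM); last exact: PV.
  exact: PMM.
apply/matrixP => i j; rewrite transvectionl mulmxDr mulmx1 -scalemxAr mxE.
congr (_ + _); rewrite mxE mul_deltar.
have [->|ia] := eqVneq i (w a); last by rewrite wM // mul0r !mulr0 mul0r.
have [->|jb] := eqVneq j b; first by rewrite !mulr1 /s divfK.
by rewrite (wM (w b) j) ?mulr0 // (inj_eq perm_inj) eq_sym.
Qed.

(** If w moves a up, some b > a of the same colour is moved to or below a;
    conjugating the transvection at (a, b) then gives one at (w a, w b). *)
Lemma root_rel_perm w M a : P M -> monomial w M -> root_rel (w a) a.
Proof.
move=> PM wM; have [sP _ _ _] := gP; have uM := sP _ PM.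
have cw j : c (w j) = c j.
  apply/eqP; apply: contraNT (monomial_neq0 j uM wM) => cj.
  by apply/eqP; exact: Pc PM _ _ cj.
have [wa|aw] := leqP (w a) a.
  by apply: colour_le_root; rewrite /colour_le wa cw eqxx.
pose S := [set x : 'I_n | (a < x)%N && (c x == c a)]%SET.
have [b bS wbS] : exists2 b, b \in S & w b \notin S.
  apply: contrapT => nex.
  have sub : w @: S \subset S.
    apply/fintype.subsetP => _ /imsetP[x xS ->]; apply: contrapT => /negP wx.
    by apply: nex; exists x.
  have /eqP wS : w @: S == S by rewrite eqEcard sub andTb (card_imset _ (@perm_inj _ w)).
  have : w a \in w @: S by rewrite wS inE aw cw eqxx.
  by rewrite mem_imset ?inE ?ltnn //; exact: perm_inj.
move: bS wbS; rewrite !inE => /andP[ab /eqP cb]; rewrite cw cb eqxx andbT -leqNgt => wba.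
apply: (root_rel_trans (y := w b)).
  apply: root_rel_monomial PM wM _; apply: colour_le_root.
  by rewrite /colour_le (ltnW ab) cb eqxx.
by apply: colour_le_root; rewrite /colour_le wba cw cb eqxx.
Qed.

Lemma root_subalgebra : mx_subalgebra (incidence (F := F) root_rel).
Proof.
apply: incidence_subalgebra; [exact: root_rel_refl | exact: root_rel_trans].
Qed.

Lemma triangular_root A : triangular_group c A -> incidence root_rel A.
Proof. by move=> [_]; apply: incidence_mono => i j; exact: colour_le_root. Qed.

Lemma overgroup_sub_incidence : P `<=` incidence root_rel.
Proof.
move=> A PA; have [sP _ PM PV] := gP; have uA := sP _ PA.
have [sT _ _ TV] := triangular_subgroup c.
have [L TL [R TR [w wM]]] := bruhat uA (Pc PA).
set M := L *m A *m R in wM.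
have PMM : P M by apply: (PM); [apply: (PM) => //|]; exact: TP.
have rM : incidence root_rel M.
  move=> i j; have [->|/wM//] := eqVneq i (w j).
  by rewrite (root_rel_perm j PMM wM).
have [_ SM] := root_subalgebra.
have -> : A = invmx L *m M *m invmx R.
  by rewrite /M -!mulmxA mulmxV ?sT // mulmx1 mulKmx ?sT.
by apply: (SM); [apply: (SM)|]; rewrite //; apply: triangular_root; exact: TV.
Qed.

(** The product of three transvections that represents the transposition of a
    and b. *)
Definition swap (a b : 'I_n) : 'M[F]_n :=
  transvection 1 a b *m transvection (- 1) b a *m transvection 1 a b.

Lemma swapE a b M i j : a != b ->
  (swap a b *m M) i j = if i == a then M b j else if i == b then - M a j else M i j.
Proof.
move=> ab; rewrite /swap -!mulmxA !transvectionl.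
have [->|ia] := eqVneq i a; rewrite ?eqxx ?(negPf ab).
  by rewrite /= [b == a]eq_sym (negPf ab) /=; ring.
have [->|ib] := eqVneq i b; rewrite /= ?eqxx ?[b == a]eq_sym ?(negPf ab) /=; ring.
Qed.

(** By induction on the number of indices that w moves: if w moves a, the swap
    of a and w a lies in P and composing with it makes a fixed. *)
Lemma monomial_in_overgroup w M : M \in unitmx -> incidence root_rel M ->
  monomial w M -> P M.
Proof.
have [sP _ PM PV] := gP; have [_ SM] := root_subalgebra.
move: {2}#|_| (leqnn #|[set j | w j != j]%SET|) => m.
elim: m w M => [|m IH] w M wm uM rM wM.
  apply: TP; split=> // i j ij.
  have /eqP wj : w j == j.
    apply: contraTT wm => wj; rewrite -ltnNge card_gt0; apply/set0Pn.
    by exists j; rewrite inE.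
  apply: wM; rewrite wj; apply: contra ij => /eqP ->; exact: colour_le_refl.
have [[a wa]|nw] := pselect (exists a, w a != a); last first.
  apply: (IH w) => //; rewrite leqNgt; apply/negP.
  move=> /(leq_ltn_trans (leq0n m))/card_gt0P[j]; rewrite inE => wj.
  by apply: nw; exists j.
have rw j : root_rel (w j) j.
  apply: contraNT (monomial_neq0 j uM wM) => nr; exact/eqP/rM.
(* iterating w leads from w a back to a *)
have raw : root_rel a (w a).
  have it k x : root_rel ((w ^+ k)%g x) x.
    elim: k x => [|k IHk] x; first by rewrite expg0 perm1 root_rel_refl.
    by rewrite expgSr permM; apply: root_rel_trans (rw _) _.
  have := it (#[w]%g).-1 (w a).
  by rewrite -permM -expgS prednK ?order_gt0 // expg_order perm1.
have PN : P (swap a (w a)).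
  have naw : a != w a by rewrite eq_sym.
  by rewrite /swap; apply: (PM); [apply: (PM)|]; apply: root_relP.
have uN := sP _ PN.
rewrite -[M](mulKmx uN); apply: (PM); first exact: PV.
apply: (IH (w * tperm a (w a))%g).
- rewrite -ltnS; apply: leq_trans wm; apply: proper_card; apply/properP; split.
    apply/fintype.subsetP => j; rewrite !inE permM; apply: contra => /eqP wj.
    rewrite wj tpermD //; first by apply: contraNneq wa => ->; rewrite wj.
    by apply: contraNneq wa => wE; rewrite wE (perm_inj (etrans wE (esym wj))).
  by exists a; rewrite !inE // permM tpermR eqxx.
- by rewrite unitmx_mul uN.
- by apply: (SM) => //; exact: overgroup_sub_incidence.
- move=> i j; rewrite permM swapE; last by rewrite eq_sym.
  case: tpermP => [wja|wjwa|/eqP wja /eqP wjwa] ij.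
  + have [ia|ia] := eqVneq i a; last by rewrite (negPf ij) wM // wja.
    by rewrite wM // wja.
  + rewrite (negPf ij); have [iw|iw] := eqVneq i (w a).
      by rewrite wM ?oppr0 // wjwa eq_sym.
    by rewrite wM // wjwa.
  + have [ia|ia] := eqVneq i a; first by rewrite wM // eq_sym.
    have [iw|iw] := eqVneq i (w a); last exact: wM.
    by rewrite wM ?oppr0 // eq_sym.
Qed.

(** The algebra on the right is block triangular.  In either direction the
    Bruhat decomposition, with triangular outer factors, reduces the inclusion
    to the monomial middle factor. *)
Lemma overgroupE : P = GL F n `&` incidence root_rel.
Proof.
have [sP _ PM PV] := gP; have [sT _ _ TV] := triangular_subgroup c.
apply/seteqP; split=> [A PA|A [uA rA]].
  by split; [exact: sP | exact: overgroup_sub_incidence].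
have [|L TL [R TR [w wM]]] := bruhat (c := c) uA.
  by apply: incidence_mono rA => i j /root_rel_colour cij; rewrite /same_colour cij.
set M := L *m A *m R in wM.
have [_ SM] := root_subalgebra.
have PMM : P M.
  apply: monomial_in_overgroup wM.
    by rewrite !unitmx_mul uA !andbT; apply/andP; split; exact: sT.
  by apply: (SM); [apply: (SM)|] => //; exact: triangular_root.
have -> : A = invmx L *m M *m invmx R.
  by rewrite /M -!mulmxA mulmxV ?sT // mulmx1 mulKmx ?sT.
by apply: (PM); [apply: (PM)|] => //; apply: TP; exact: TV.
Qed.

End Saturation.
End Overgroups.

(** * Parabolic subgroups as groups of units *)

Section Parabolic.
Variables (F : numClosedFieldType) (n : nat).
Implicit Types (A B : 'M[F]_n) (S Q : set 'M[F]_n).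

Lemma subalgebraJ S g : g \in unitmx -> mx_subalgebra S ->
  mx_subalgebra [set A | S (g *m A *m invmx g)].
Proof.
move=> ug [[S1 SL] SM]; split=> [|A B SA SB /=].
  split=> [/=|a A B SA SB /=]; first by rewrite mulmx1 mulmxV.
  by rewrite mulmxDr mulmxDl -scalemxAr -scalemxAl; exact: SL.
by have := SM _ _ SA SB; rewrite !mulmxA (mulmxKV ug).
Qed.

Lemma subalgebraI S S' : mx_subalgebra S -> mx_subalgebra S' -> mx_subalgebra (S `&` S').
Proof.
move=> [[S1 SL] SM] [[S1' SL'] SM']; split=> [|A B [SA SA'] [SB SB']].
  by split=> [//|a A B [SA SA'] [SB SB']]; split; [exact: SL | exact: SL'].
by split; [exact: SM | exact: SM'].
Qed.

Section Centraliser.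
Variable I : 'M[F]_n.
Hypotheses (uI : I \in unitmx) (spanI : eigenspaces_span I).

Local Notation KK := (fixed_points (theta_inv I) (GL F n)).

Lemma centraliserP A : KK A <-> A \in unitmx /\ I *m A = A *m I.
Proof.
split=> [[uA IA]|[uA IA]]; split=> //; last by rewrite /theta_inv /= IA mulmxK.
by rewrite -[in RHS]IA /theta_inv mulmxKV.
Qed.

(** A Borel subgroup of the centraliser is triangular in a basis of
    eigenvectors of I by the Lie--Kolchin theorem.  The full triangular group
    is itself closed, connected and solvable, so maximality gives equality;
    a parabolic subgroup is then an overgroup of a triangular group. *)
Theorem parabolic_units Q : parabolic_subgroup KK Q ->
  exists2 S, mx_subalgebra S & Q = GL F n `&` S.
Proof.
move=> [[gQ _] QK [B [[[gB _] Bc Bsol] BK Bmax] BQ]].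
have BI h : B h -> h *m I = I *m h by move=> /BK/centraliserP[].
have [g ug [c [gI gB0]]] := adapted_basis spanI BI gB Bc Bsol.
have uV : invmx g \in unitmx by rewrite unitmx_inv.
have gIE : g *m I = diag_mx (\row_i c i) *m g.
  apply/matrixP => i j; have /rowP/(_ j) := gI i.
  by rewrite -row_mul [row _ _ _ _]mxE => ->; rewrite mul_diag_mx !mxE.
have cK A : A \in unitmx -> KK A <-> incidence (same_colour c) (g *m A *m invmx g).
  move=> uA; move CE': (g *m A *m invmx g) => C.
  have CE : C *m g = g *m A by rewrite -CE' mulmxKV.
  have com : I *m A = A *m I <->
      diag_mx (\row_i c i) *m C = C *m diag_mx (\row_i c i).
    have E1 : g *m (I *m A) = diag_mx (\row_i c i) *m C *m g.
      by rewrite mulmxA gIE -!mulmxA CE.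
    have E2 : g *m (A *m I) = C *m diag_mx (\row_i c i) *m g.
      by rewrite mulmxA -CE -!mulmxA gIE.
    split=> [E|E]; last by apply: (can_inj (mulKmx ug)); rewrite E1 E2 E.
    by apply: (can_inj (mulmxK ug)); rewrite -E1 -E2 E.
  have entry i j : (diag_mx (\row_i c i) *m C) i j - (C *m diag_mx (\row_i c i)) i j =
      (c i - c j) * C i j.
    by rewrite mul_diag_mx mul_mx_diag !mxE mulrBl [C i j * _]mulrC.
  rewrite centraliserP com; split=> [[_ E] i j|cC].
    rewrite /same_colour -subr_eq0 => cij; apply: (mulfI cij).
    by rewrite -entry E subrr mulr0.
  split=> //; apply/matrixP => i j; apply/eqP; rewrite -subr_eq0 entry mulf_eq0 subr_eq0.
  have [cij|nij] := boolP (same_colour c i j).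
    by move: cij; rewrite /same_colour => ->.
  by rewrite cC // eqxx orbT.
pose T := [set invmx g *m A *m g | A in triangular_group c].
have gT0 := triangular_subgroup c; have [sT0 _ _ _] := gT0.
pose rho A := invmx g *m A *m g.
have rho1 : rho 1%:M = 1%:M by rewrite /rho mulmx1 mulVmx.
have rhoM A A' : triangular_group c A -> triangular_group c A' ->
    rho (A *m A') = rho A *m rho A'.
  by move=> _ _; rewrite /rho !mulmxA (mulmxK ug).
have TE A : T A <-> A \in unitmx /\ incidence (colour_le c) (g *m A *m invmx g).
  split=> [[C [uC tC] <-]|[uA tA]].
    by rewrite !unitmx_mul uV uC ug !mulmxA mulmxV // mul1mx mulmxK.
  exists (g *m A *m invmx g); last by rewrite !mulmxA mulVmx // mul1mx mulmxKV.
  by split=> //; rewrite /GL /= !unitmx_mul ug uA uV.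
have TK : T `<=` KK.
  move=> A /TE[uA tA]; apply/cK => //.
  by apply: incidence_mono tA => i j /andP[].
have BT : T = B.
  apply: Bmax => //; last first.
    move=> h Bh; apply/TE; have [uh _] := BK h Bh; split=> // i j.
    rewrite /colour_le negb_and -ltnNge => /orP[ji|cij]; first exact: gB0.
    by have /cK := BK h Bh; apply.
  have gT : mx_subgroup T by apply: (image_group_sub gT0 rho1 rhoM gT0).
  split.
  - split=> //.
    have [|Z Zc ZE] := @regular_zeros F n ('I_n * 'I_n)%type
      [set ij | ~~ colour_le c ij.1 ij.2] (fun ij A => (g *m A *m invmx g) ij.1 ij.2).
      move=> ij; repeat apply: regular_mxM;
        by [exact: regular_mx_id | exact: regular_mx_cst].
    exists Z => //; apply/seteqP; split=> A.
      by move=> /TE[uA tA]; split=> //; apply/ZE => // -[i j]; exact: tA.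
    move=> [uA /ZE zA]; apply/TE; split=> // i j ij.
    exact: (zA uA (i, j)).
  - apply: zconnected_image; [exact: sT0 | | exact: triangular_connected].
    repeat apply: regular_mxM; by [exact: regular_mx_id | exact: regular_mx_cst].
  - exists n; apply/seteqP; split=> A.
      move=> /(derived_iter_image gT0 rho1 rhoM).
      by rewrite triangular_solvable => -[_ -> <-].
    by move=> ->; have [] := derived_iter_group n gT.
pose P := [set g *m A *m invmx g | A in Q].
have [sQ Q1 QM QV] := gQ.
have gP : mx_subgroup P.
  apply: (image_group_sub gQ _ _ gQ) => //; first by rewrite mulmx1 mulmxV.
  by move=> A A' _ _; rewrite !mulmxA (mulmxKV ug).
have TP : triangular_group c `<=` P.
  move=> A TA; exists (invmx g *m A *m g).
    2: by rewrite !mulmxA mulmxV // mul1mx mulmxK.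
  by apply: BQ; rewrite -BT; exists A.
have Pc : P `<=` incidence (same_colour c).
  by move=> _ [A QA <-]; apply/cK; [exact: sQ | exact: QK].
exists [set A | incidence (root_rel P) (g *m A *m invmx g)].
  by apply: subalgebraJ => //; exact: root_subalgebra.
have PE A : P A <-> A \in unitmx /\ incidence (root_rel P) A.
  by rewrite {1}(overgroupE gP TP Pc).
apply/seteqP; split=> A => [QA|[uA rA]].
  split; first exact: sQ.
  by have /PE[] : P (g *m A *m invmx g) by exists A.
have /PE : g *m A *m invmx g \in unitmx /\
    incidence (root_rel P) (g *m A *m invmx g).
  by split=> //; rewrite !unitmx_mul ug uA uV.
by move=> [C QC /(can_inj (mulmxKV ug))/(can_inj (mulKmx ug)) <-].
Qed.

End Centraliser.

Lemma not_row_full (U : 'M[F]_n) : ~~ row_full U -> exists v : 'rV[F]_n, ~~ (v <= U)%MS.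
Proof. by rewrite -sub1mx => /row_subPn[i iU]; exists (row i 1%:M). Qed.

Lemma eigenspaces_span1 : eigenspaces_span (1%:M : 'M[F]_n).
Proof.
move=> U /not_row_full[v vU]; exists 1; exists v => //.
by rewrite mulmx1 scale1r.
Qed.

Lemma theta_inv1 : fixed_points (theta_inv 1%:M) (GL F n) = GL F n.
Proof.
apply/seteqP; split=> [A []//|A uA]; split=> //=.
by rewrite /theta_inv invmx1 mulmx1 mul1mx.
Qed.

Lemma central_scalar A : (forall g, g \in unitmx -> A *m g = g *m A) ->
  exists a, A = a%:M.
Proof.
move=> cA.
have cE i j : i != j -> A *m delta_mx i j = delta_mx i j *m A.
  move=> ij; have [u _] := mulmx1_unit (transvectionV (1 : F) ij).
  have := cA _ u; rewrite /transvection scale1r mulmxDr mulmxDl mulmx1 mul1mx.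
  exact: addrI.
case: n A cA cE => [|m] A cA cE; first by exists 0; rewrite [LHS]flatmx0 [RHS]flatmx0.
exists (A ord0 ord0); apply/matrixP => i j; rewrite mxE.
have [<-|ij] := eqVneq i j.
  have [->//|i0] := eqVneq i ord0; have := cE _ _ i0.
  by move=> /matrixP/(_ i ord0); rewrite mul_deltar mul_deltal !eqxx mulr1 mul1r.
have ji : j != i by rewrite eq_sym.
have := cE _ _ ji => /matrixP/(_ i i).
by rewrite mul_deltar mul_deltal eqxx (negPf ij) mulr1 mul0r.
Qed.

(** Since theta is an involution I ^ 2 is a scalar d ^ 2, and every row vector
    is a combination of v I + d v and v I - d v, eigenvectors for d and - d. *)
Lemma eigenspaces_span_involution (I : 'M[F]_n) : I \in unitmx ->
  (forall g, GL F n g -> theta_inv I (theta_inv I g) = g) -> eigenspaces_span I.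
Proof.
move=> uI thK U nU; have [v vU] := not_row_full nU.
have [x xE] : exists x, I *m I = x%:M.
  apply: central_scalar => g ug; rewrite -[in RHS](thK g ug) /theta_inv.
  by rewrite !mulmxA !(mulmxKV uI).
pose d := Num.Theory.sqrtC x; have d2 : d * d = x by rewrite -expr2 Num.Theory.sqrtCK.
have eig e : e * e = x -> (v *m I + e *: v) *m I = e *: (v *m I + e *: v).
  move=> e2; rewrite mulmxDl -mulmxA xE mul_mx_scalar -scalemxAl scalerDr scalerA e2.
  by rewrite addrC.
have [plus|plus] := boolP ((v *m I + d *: v)%R <= U)%MS; last first.
  by exists d; exists (v *m I + d *: v); [exact: (eig d d2) | exact: plus].
have [minus|minus] := boolP ((v *m I + (- d) *: v)%R <= U)%MS; last first.
  exists (- d); exists (v *m I + (- d) *: v); last exact: minus.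
  by apply: eig; rewrite mulrNN.
have d0 : d != 0.
  apply: contraNneq vU => d0.
  have vII : v *m I *m I = 0.
    by rewrite -mulmxA xE -d2 d0 mul0r mul_mx_scalar scale0r.
  by rewrite -[v](mulmxK uI) -[v *m I](mulmxK uI) vII !mul0mx sub0mx.
have vE : v = (d + d)^-1 *: (v *m I + d *: v - (v *m I + (- d) *: v)).
  rewrite opprD addrACA subrr add0r scaleNr opprK -scalerDl scalerA mulVf ?scale1r //.
  by rewrite -mulr2n Num.Theory.mulrn_eq0.
case/negP: vU; rewrite vE scalemx_sub // addmx_sub //.
by rewrite -scaleN1r scalemx_sub.
Qed.

(** * Square roots *)

Section Sigma.
Variables (J : 'M[F]_n).
Hypothesis uJ : J \in unitmx.
Local Notation sigma := (sigma_inv J).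

Lemma sigma_invM A B : A \in unitmx -> B \in unitmx ->
  sigma (A *m B) = sigma A *m sigma B.
Proof.
by move=> uA uB; rewrite /sigma_inv invmxM // trmx_mul !mulmxA (mulmxKV uJ).
Qed.

Lemma sigma_inv_unit A : A \in unitmx -> sigma A \in unitmx.
Proof. by move=> uA; rewrite /sigma_inv !unitmx_mul unitmx_tr !unitmx_inv uJ uA. Qed.

Lemma sigma_inv1 : sigma 1%:M = 1%:M.
Proof. by rewrite /sigma_inv invmx1 trmx1 mulmx1 mulmxV. Qed.

Lemma sigma_invV A : A \in unitmx -> sigma (invmx A) = invmx (sigma A).
Proof.
move=> uA; have u := sigma_inv_unit uA; apply: (can_inj (mulKmx u)).
by rewrite mulmxV // -sigma_invM ?unitmx_inv // mulmxV // sigma_inv1.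
Qed.

(** Up to inversion, sigma is the anti-involution A |-> J A^T J^-1.  It fixes h
    exactly when sigma h = h^-1, and then it fixes every polynomial in h,
    among which is a square root of h; being a polynomial in h, that root stays
    in every algebra that contains h. *)
Lemma units_minus_square_roots S : mx_subalgebra S ->
  admits_minus_square_roots sigma (GL F n `&` S).
Proof.
move=> aS h [[uh Sh] /= sh].
have th : J *m h^T *m invmx J = h.
  have uhT : h^T \in unitmx by rewrite unitmx_tr.
  rewrite -[RHS]invmxK -sh /sigma_inv trmx_inv.
  by rewrite !invmxM ?unitmx_mul ?unitmx_inv ?uJ ?uhT //= !invmxK mulmxA.
have [f hf fE] := poly_in_sqrt uh.
have uf : f \in unitmx by have : h \in unitmx := uh; rewrite fE unitmx_mul => /andP[].
exists f => //; split; first by split=> //; exact: (poly_in_subalgebra aS Sh hf).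
have [tf _] : J *m f^T *m invmx J = f /\ f *m h = h *m f.
  apply: (@poly_in_ind F n h [set f | J *m f^T *m invmx J = f /\ f *m h = h *m f]) hf.
    split=> [|a A B [tA cA] [tB cB]] /=.
      by rewrite trmx1 !mulmx1 mulmxV // mul1mx.
    split; last by rewrite mulmxDl mulmxDr -scalemxAl -scalemxAr cA cB.
    by rewrite linearD linearZ /= mulmxDr mulmxDl -scalemxAr -scalemxAl tA tB.
  move=> B [tB cB] /=; split; last by rewrite mulmxA cB.
  by rewrite trmx_mul cB -[in RHS]tB -[in RHS]th !mulmxA (mulmxKV uJ).
have ufT : f^T \in unitmx by rewrite unitmx_tr.
rewrite /= -[in RHS]tf !invmxM ?unitmx_mul ?unitmx_inv ?uJ ?ufT //.
by rewrite invmxK -trmx_inv mulmxA.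
Qed.

Lemma fixed_points_subgroup H : mx_subgroup H -> mx_subgroup (fixed_points sigma H).
Proof.
move=> [sH H1 HM HV]; split=> [A [/sH]//||A B [HA sA] [HB sB]|A [HA sA]].
- by split=> //; exact: sigma_inv1.
- split; first exact: HM.
  by rewrite /= sigma_invM ?sA ?sB //; exact: sH.
- split; first exact: HV.
  by rewrite /= sigma_invV ?sA //; exact: sH.
Qed.

End Sigma.
End Parabolic.

(** * Orbits on double flag varieties *)

Section Orbits.
Variables (F : fieldType) (n : nat).
Implicit Types (H K A B : set 'M[F]_n) (g h k : 'M[F]_n).
Implicit Types (x y : set 'M[F]_n * set 'M[F]_n).

Lemma translateM g h A : translate g (translate h A) = translate (g *m h) A.
Proof.
apply/seteqP; split=> [_ [_ [a Aa <-] <-]|_ [a Aa <-]].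
  by exists a; rewrite ?mulmxA.
by exists (h *m a); [exists a | rewrite mulmxA].
Qed.

Lemma translate_id H h : mx_subgroup H -> H h -> translate h H = H.
Proof.
move=> [sH H1 HM HV] Hh; apply/seteqP; split=> [_ [a Ha <-]|a Ha]; first exact: HM.
by exists (invmx h *m a); [apply: HM => //; exact: HV | rewrite mulKVmx //; exact: sH].
Qed.

Lemma translate1 A : translate 1%:M A = A.
Proof.
apply/seteqP; split=> [_ [a Aa <-]|a Aa]; first by rewrite mul1mx.
by exists a; rewrite ?mul1mx.
Qed.

Lemma translate_eq H g h : mx_subgroup H -> translate g H = translate h H ->
  exists2 q, H q & g = h *m q.
Proof.
move=> [sH H1 HM HV] gh; have : translate g H g by exists 1%:M; rewrite ?mulmx1.
by rewrite gh => -[q Hq qE]; exists q.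
Qed.

Lemma mulmx_set_translate g A B :
  mulmx_set (translate g A) B = translate g (mulmx_set A B).
Proof.
apply/seteqP; split=> [_ [_ [a Aa <-] [b Bb <-]]|_ [_ [a Aa [b Bb <-]] <-]].
  by exists (a *m b); [exists a => //; exists b | rewrite mulmxA].
by exists (g *m a); [exists a | exists b => //; rewrite mulmxA].
Qed.

Lemma embed_diag_act A B g x : embed A B (diag_act g x) = diag_act g (embed A B x).
Proof. by rewrite /embed /diag_act /= !mulmx_set_translate. Qed.

Lemma diag_actM g h x : diag_act g (diag_act h x) = diag_act (g *m h) x.
Proof. by rewrite /diag_act /= !translateM. Qed.

Lemma diag_act1 x : diag_act 1%:M x = x.
Proof. by case: x => A B; rewrite /diag_act /= !translate1. Qed.

Lemma saturate_diag_act K k x : mx_subgroup K -> K k ->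
  saturate K [set diag_act k x] = saturate K [set x].
Proof.
move=> [sK K1 KM KV] Kk; apply/seteqP; split=> _ [g Kg [_ -> <-]].
  by exists (g *m k); [exact: KM | exists x => //; rewrite diag_actM].
exists (g *m invmx k); first by apply: KM => //; exact: KV.
by exists (diag_act k x) => //; rewrite diag_actM mulmxKV //; exact: sK.
Qed.

Lemma orbit_map_saturate KK K A B x : mx_subgroup KK -> K `<=` KK -> K 1%:M ->
  orbit_map KK A B (saturate K [set x]) = saturate KK [set embed A B x].
Proof.
move=> [sK K1 KM KV] KKK K1'; apply/seteqP; split=> z.
  move=> [m Km [_ [_ [k Kk [_ -> <-]] <-] <-]].
  exists (m *m k); first by apply: KM => //; exact: KKK.
  by exists (embed A B x) => //; rewrite embed_diag_act diag_actM.
move=> [m Km [_ -> <-]]; exists m => //; exists (embed A B x) => //.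
by exists x => //; exists 1%:M => //; exists x => //; rewrite diag_act1.
Qed.

End Orbits.

(** The twisted intersection argument: m^-1 sigma(m) measures how far m is from
    being sigma-fixed, it stabilises both cosets, and it is sent to its inverse
    by sigma; correcting m by a square root of it gives a sigma-fixed element
    that relates the same cosets. *)
Lemma fixed_mover (F : numClosedFieldType) n (J : 'M[F]_n)
    (SP SQ : set 'M[F]_n) (m k k' g g' : 'M[F]_n) :
  J \in unitmx ->
  (forall a, a \in unitmx -> sigma_inv J (sigma_inv J a) = a) ->
  mx_subalgebra SP -> mx_subalgebra SQ ->
  (forall a, (GL F n `&` SP) a -> SP (sigma_inv J a)) ->
  (forall a, (GL F n `&` SQ) a -> SQ (sigma_inv J a)) ->
  [/\ m \in unitmx, k \in unitmx, k' \in unitmx, g \in unitmx & g' \in unitmx] ->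
  sigma_inv J k = k -> sigma_inv J k' = k' ->
  sigma_inv J g = g -> sigma_inv J g' = g' ->
  SQ (invmx k' *m m *m k) -> SP (invmx g' *m m *m g) ->
  exists f, [/\ f \in unitmx, sigma_inv J (m *m f) = m *m f,
    SQ (invmx k *m f *m k) & SP (invmx g *m f *m g)].
Proof.
move=> uJ sK aP aQ sP sQ [um uk uk' ug ug'] sk sk' sg sg' mQ mP.
pose s := sigma_inv J.
have sM a b : a \in unitmx -> b \in unitmx -> s (a *m b) = s a *m s b.
  exact: sigma_invM.
have sV a : a \in unitmx -> s (invmx a) = invmx (s a) by exact: sigma_invV.
have uS a : a \in unitmx -> s a \in unitmx by exact: sigma_inv_unit.
have usm := uS _ um.
have stab S h h' : mx_subalgebra S -> (forall b, (GL F n `&` S) b -> S (s b)) ->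
    h \in unitmx -> h' \in unitmx -> s h = h -> s h' = h' ->
    S (invmx h' *m m *m h) -> S (invmx h *m (invmx m *m s m) *m h).
  move=> aS sS uh uh' sh sh' Sm.
  set q := invmx h' *m m *m h in Sm.
  have uq : q \in unitmx by rewrite !unitmx_mul unitmx_inv uh' um uh.
  have sq : s q = invmx h' *m s m *m h.
    by rewrite /q !sM ?unitmx_mul ?unitmx_inv ?uh' ?um // sV // sh sh'.
  have -> : invmx h *m (invmx m *m s m) *m h = invmx q *m s q.
    rewrite sq /q !invmxM ?unitmx_mul ?unitmx_inv ?uh' ?um // invmxK.
    by rewrite !mulmxA (mulmxK uh').
  have [_ SM] := aS; apply: SM; last by apply: sS; split.
  exact: (poly_in_subalgebra aS Sm (poly_in_invmx uq)).
pose S := [set a | SQ (invmx k *m a *m k)] `&` [set a | SP (invmx g *m a *m g)].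
have aS : mx_subalgebra S.
  have conjS (S' : set 'M[F]_n) h : h \in unitmx -> mx_subalgebra S' ->
      mx_subalgebra [set a | S' (invmx h *m a *m h)].
    move=> uh aS'; have := @subalgebraJ F n S' (invmx h) _ aS'.
    by rewrite invmxK unitmx_inv; apply.
  by apply: subalgebraI; exact: conjS.
have [|f [[uf [fQ fP]] sf] fE] := units_minus_square_roots uJ aS (h := invmx m *m s m).
  split; first split.
  - by rewrite /GL /= unitmx_mul unitmx_inv um usm.
  - by split; [exact: (stab SQ k k') | exact: (stab SP g g')].
  - have ssm : s (s m) = m := sK m um.
    rewrite /= -/s sM ?unitmx_inv // sV // ssm [RHS]invmxM ?unitmx_inv //.
    by rewrite invmxK.
exists f; split=> //.
rewrite -/s sM //; have -> : s f = invmx f := sf.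
have -> : s m = m *m (f *m f) by rewrite -fE mulKVmx.
by rewrite mulmxA (mulmxK uf).
Qed.

Theorem proposition15p1 (R : realType) (n : nat) (I J : 'M[R[i]]_n)
    (theta := theta_inv I) (sigma := sigma_inv J)
    (GG := GL R[i] n) (KK := fixed_points theta GG)
    (G := fixed_points sigma GG) (K := fixed_points theta G) :
  I \in unitmx -> J \in unitmx ->
  (forall g, GG g -> theta (theta g) = g) ->
  (forall g, GG g -> sigma (sigma g) = g) ->
  (forall g, GG g -> theta (sigma g) = sigma (theta g)) ->
  zconnected G -> zconnected K -> zconnected KK ->
  forall PP QQ : set 'M[R[i]]_n,
    parabolic_subgroup GG PP -> stable_under sigma PP ->
    parabolic_subgroup KK QQ -> stable_under sigma QQ ->
    condition_E sigma GG KK PP QQ /\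
    (let P := fixed_points sigma PP in
     let Q := fixed_points sigma QQ in
     let X := double_flag K Q G P in
     let XX := double_flag KK QQ GG PP in
     set_fun (orbit_space K X) (orbit_space KK XX) (orbit_map KK QQ PP) /\
     set_inj (orbit_space K X) (orbit_map KK QQ PP)).
Proof.
move=> uI uJ thK sK thsC _ _ _ PP QQ parP stP parQ stQ.
have unitsP : forall P, parabolic_subgroup GG P ->
    exists2 S, mx_subalgebra S & P = GG `&` S.
  move=> P; have := parabolic_units (unitmx1 _ _) (@eigenspaces_span1 R[i] n) (Q := P).
  by rewrite theta_inv1.
have unitsQ : forall Q, parabolic_subgroup KK Q ->
    exists2 S, mx_subalgebra S & Q = GG `&` S.
  exact: (parabolic_units uI (eigenspaces_span_involution uI thK)).
have [SP aSP PE] := unitsP PP parP; have [SQ aSQ QE] := unitsQ QQ parQ.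
have gP : mx_subgroup PP by rewrite PE; exact: units_subgroup.
have gQ : mx_subgroup QQ by rewrite QE; exact: units_subgroup.
split.
  split; [by rewrite PE; exact: units_minus_square_roots |
          by rewrite QE; exact: units_minus_square_roots |].
  (* an intersection of groups of units of algebras is again one *)
  move=> P1 Q1 /unitsP[S1 aS1 ->] _ /unitsQ[S2 aS2 ->] _ _ _.
  by rewrite setIACA setIid; apply: units_minus_square_roots => //; exact: subalgebraI.
move=> P Q X XX.
have gG : mx_subgroup GG.
  split=> [//||g h ug uh|g ug]; rewrite /GG /GL /= ?unitmx1 ?unitmx_inv //.
  by rewrite unitmx_mul; apply/andP.
have QK : QQ `<=` KK by have [] := parQ.
have KKG : KK `<=` GG by move=> ? [].
have KG : K `<=` G by move=> ? [].
have gGG : mx_subgroup G by exact: fixed_points_subgroup.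
have cP A : KK A <-> A \in unitmx /\ I *m A = A *m I by exact: centraliserP.
have gKK : mx_subgroup KK.
  split=> [//||A B /cP[uA IA] /cP[uB IB]|A /cP[uA IA]]; apply/cP.
  - by rewrite unitmx1 mulmx1 mul1mx.
  - by rewrite unitmx_mul uA uB mulmxA IA -!mulmxA IB.
  - rewrite unitmx_inv; split=> //; apply: (can_inj (mulKmx uA)).
    by rewrite !mulmxA -IA (mulmxK uA) mulmxV // mul1mx.
have KE : K = fixed_points sigma KK.
  apply/seteqP; split=> A; first by move=> [[? ?] ?].
  by move=> [[? ?] ?].
have gK : mx_subgroup K by rewrite KE; exact: fixed_points_subgroup.
have KKK : K `<=` KK by rewrite KE => ? [].
have [_ K1 _ _] := gK.
have gfP : mx_subgroup P by exact: fixed_points_subgroup.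
have gfQ : mx_subgroup Q by exact: fixed_points_subgroup.
have omE x : orbit_map KK QQ PP (saturate K [set x]) =
    saturate KK [set embed QQ PP x] by exact: orbit_map_saturate.
have emE k g : embed QQ PP (translate k Q, translate g P) =
    (translate k QQ, translate g PP).
  have [_ Q1 _ _] := gfQ; have [_ P1 _ _] := gfP.
  by apply: embed_cosets => // ? [].
split.
  move=> _ [[A B] [/= [k Kk <-] [g Gg <-]] <-].
  rewrite omE emE; exists (translate k QQ, translate g PP) => //.
  by split=> /=; [exists k => //; exact: KKK | exists g => //; case: Gg].
move=> O1 O2 /set_mem[[A1 B1] [/= [k Kk <-] [g Gg <-]] <-].
move=> /set_mem[[A2 B2] [/= [k' Kk' <-] [g' Gg' <-]] <-].
rewrite !omE !emE => E.
(* an element of KK that carries the first pair of cosets to the second *)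
have [m KKm [mk mg]] : exists2 m, KK m &
    translate (m *m k) QQ = translate k' QQ /\ translate (m *m g) PP = translate g' PP.
  have : saturate KK [set (translate k' QQ, translate g' PP)]
      (translate k' QQ, translate g' PP).
    exists 1%:M; first by have [] := gKK.
    by exists (translate k' QQ, translate g' PP) => //; rewrite diag_act1.
  rewrite -E => -[m KKm [_ -> ]]; rewrite /diag_act /= !translateM => -[mk mg].
  by exists m.
have [q Qq qE] := translate_eq gQ mk; have [p Pp pE] := translate_eq gP mg.
have um : m \in unitmx := KKG _ KKm.
have [[uk sk] _] := Kk; have [[uk' sk'] _] := Kk'.
have [ug sg] := Gg; have [ug' sg'] := Gg'.
have sst (S : set 'M[R[i]]_n) H : H = GG `&` S -> stable_under sigma H ->
    forall a, (GG `&` S) a -> S (sigma a).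
  move=> HE st a; rewrite -HE => Ha.
  have : H (sigma a) by rewrite -st; exists a.
  by rewrite HE => -[].
have SqQ : SQ (invmx k' *m m *m k).
  by rewrite -mulmxA qE mulKmx //; move: Qq; rewrite QE => -[].
have SpP : SP (invmx g' *m m *m g).
  by rewrite -mulmxA pE mulKmx //; move: Pp; rewrite PE => -[].
have [f [uf smf fQ fP]] := fixed_mover uJ sK aSP aSQ (sst _ _ PE stP) (sst _ _ QE stQ)
  (And5 um uk uk' ug ug') sk sk' sg sg' SqQ SpP.
have [_ _ QM _] := gQ; have [_ _ PM _] := gP; have [_ _ KKM KKV] := gKK.
have [_ _ GM GV] := gGG.
have Qf : QQ (invmx k *m f *m k).
  by rewrite QE; split=> //; rewrite /GG /GL /= !unitmx_mul unitmx_inv uk uf.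
have Pf : PP (invmx g *m f *m g).
  by rewrite PE; split=> //; rewrite /GG /GL /= !unitmx_mul unitmx_inv ug uf.
have KKf : KK f.
  have := KKM _ _ (KKM _ _ (KKK _ Kk) (QK _ Qf)) (KKV _ (KKK _ Kk)).
  by rewrite !mulmxA mulmxV // mul1mx (mulmxK uk).
have Kmf : K (m *m f) by rewrite KE; split=> //; exact: KKM.
have coset H h h' : mx_subgroup H -> G h -> G h' -> H (invmx h' *m (m *m f) *m h) ->
    translate h' (fixed_points sigma H) = translate (m *m f *m h) (fixed_points sigma H).
  move=> gH Gh Gh' Hmf; have [uh' _] := Gh'.
  have -> : m *m f *m h = h' *m (invmx h' *m (m *m f) *m h).
    by rewrite !mulmxA mulmxV // mul1mx.
  have gfH : mx_subgroup (fixed_points sigma H) by exact: fixed_points_subgroup.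
  rewrite -translateM (translate_id (h := invmx h' *m (m *m f) *m h) gfH) //.
  split=> //; suff [] : G (invmx h' *m (m *m f) *m h) by [].
  by apply: (GM) => //; apply: (GM); [exact: GV | exact: KG].
have -> : (translate k' Q, translate g' P) =
    diag_act (m *m f) (translate k Q, translate g P).
  rewrite /diag_act /= !translateM; congr (_, _); apply: coset => //; try exact: KG.
    have := QM _ _ Qq Qf; rewrite -[q](mulKmx uk') -qE.
    by rewrite !mulmxA (mulmxK uk).
  have := PM _ _ Pp Pf; rewrite -[p](mulKmx ug') -pE.
  by rewrite !mulmxA (mulmxK ug).
by rewrite saturate_diag_act.
Qed.
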